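(* Assume (F0)–(F5). Let $t\in[0,T]$ be fixed and assume that there exist $u,v\in\mathcal{C}(t)$ such that $$F_t(u)-F_t(v)=c_t(u,v),$$ where $c_t$ is the energy-dissipation cost. Then there exist a set of distinct points $\{u^0,u^1,\dots,u^m\}\subseteq\mathcal{C}(t)$ with $u^0=u$, $u^m=v$, and a family of functions $(v^i)_{i=1,\dots,m}$, $v^i:\mathbb{R}\to X$, such that for every $i=1,\dots,m$: $$A\ddot v^i(s)+B\dot v^i(s)+\nabla_xF_t(v^i(s))=0\quad\text{for all }s\in\mathbb{R},$$ $$\lim_{s\to-\infty}v^i(s)=u^{i-1},\qquad\lim_{s\to+\infty}v^i(s)=u^i,\qquad\lim_{s\to\pm\infty}\dot v^i(s)=0.$$
   Context: Setting: $T>0$; $(X,\|\cdot\|)$ is a Euclidean space of dimension $n\ge1$ with inner product $\langle\cdot,\cdot\rangle$; $A,B:X\to X$ are symmetric, positive definite linear operators; $F:[0,T]\times X\to\mathbb{R}$, and $F_t(\cdot):=F(t,\cdot)$. For a symmetric positive definite operator $Q$, $\|u\|_Q:=\langle u,Qu\rangle^{1/2}$. $B_M$ is the closed ball of radius $M$ centered at $0$. Energy-dissipation cost: for $t\in[0,T]$ and $u_1,u_2\in X$, $$c_t(u_1,u_2):=\inf\Big\{\frac12\int_{-N}^{N}\|\nabla_xF_t(w(s))+A\ddot w(s)\|_{B^{-1}}^2+\|\dot w(s)\|_B^2\,ds:\ w\in V^{t,N}_{u_1,u_2},\ N\in\mathbb{N}\Big\},$$ $$V^{t,N}_{u_1,u_2}:=\{w\in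 W^{2,2}([-N,N],X):w(-N)=u_1,\ w(N)=u_2,\ \dot w(-N)=\dot w(N)=0\}.$$ Assumptions on $F$: (F0) $F\in C^1([0,T]\times X)$. (F1) For every $\rho>0$ the set $\{u\in X:\sup_{t\in[0,T]}|F(t,u)|\le\rho\}$ is bounded. (F2) There exist $C_1,C_2>0$ with $|\partial_tF(t,u)|\le C_1F(t,u)+C_2$ for all $(t,u)\in[0,T]\times X$. (F3) For every $M>0$ there is $a_M\in L^1(0,T)$ such that $|\partial_t\nabla_xF(t,u)|\le a_M(t)$ for every $t\in[0,T]$ and $u\in B_M$. (F4) $F(t,\cdot)\in C^2(X)$ for every $t\in[0,T]$ and the Hessian $\nabla_x^2F(t,u)$ is continuous on $[0,T]\times X$. (F5) For every $t\in[0,T]$ the critical set $\mathcal{C}(t):=\{u\in X:\nabla_xF(t,u)=0\}$ consists of isolated points. *)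

(* Defs.v *)
From HB Require Import structures.
From mathcomp Require Import all_boot all_order all_algebra.
From mathcomp Require Import all_classical all_reals all_analysis.

Set Implicit Arguments.
Unset Strict Implicit.
Unset Printing Implicit Defensive.

Import Order.TTheory GRing.Theory Num.Theory.
Import numFieldNormedType.Exports.

Local Open Scope classical_set_scope.
Local Open Scope ring_scope.

(* The Euclidean space of dimension n.+1 is 'cV[R]_n.+1 with the standard inner
   product [dot].  MathComp-Analysis puts the sup norm on matrices: it is used
   only for topological notions (limits, continuity, differentiability,
   boundedness); the Euclidean norm is [enorm], the weighted norms are [qnorm]. *)

Section Euclidean.
Context {R : realType} {n : nat}.
Implicit Types (x y : 'cV[R]_n.+1) (Q : 'M[R]_n.+1) (f : 'cV[R]_n.+1 -> R).

Definition dot x y : R := \sum_i x i 0 * y i 0.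

Definition qnorm Q x : R := Num.sqrt (dot x (Q *m x)).

Definition enorm x : R := Num.sqrt (dot x x).

Definition sym_posdef Q : Prop :=
  Q^T = Q /\ forall x, x != 0 -> 0 < dot x (Q *m x).

Definition grad f x : 'cV[R]_n.+1 := \col_i 'D_(delta_mx i 0) f x.

Definition hess f x : 'M[R]_n.+1 :=
  \matrix_(i, j) 'D_(delta_mx j 0) (fun y => grad f y i 0) x.

Definition C2 f : Prop :=
  [/\ forall x, differentiable f x,
      forall x, differentiable (grad f) x
    & continuous (hess f)].

End Euclidean.

(* Derivative of g at t relative to D; on D = [0, T] it is one-sided at the
   endpoints, so values of g outside [0, T] are irrelevant. *)
Section DerivativeWithin.
Context {R : realType} {V : normedModType R}.
Implicit Types (D : set R) (g : R -> V) (t : R).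

Definition difference_quotient g t : R -> V :=
  fun s => (s - t)^-1 *: (g s - g t).

Definition derivable_within D g t : Prop :=
  cvg (difference_quotient g t @ within D t^').

Definition derive_within D g t : V :=
  lim (difference_quotient g t @ within D t^').

End DerivativeWithin.

(* F : [0, T] x X -> R is represented by a function on R x X of which only the
   values at times in [0, T] are ever used. *)
Section Assumptions.
Context {R : realType} {n : nat}.
Variables (T : R) (F : R -> 'cV[R]_n.+1 -> R).

Let I : set R := `[0, T].

Definition dt_F (t : R) (u : 'cV[R]_n.+1) : R :=
  derive_within I (fun s => F s u) t.

Definition dt_grad_F (t : R) (u : 'cV[R]_n.+1) : 'cV[R]_n.+1 :=
  derive_within I (fun s => grad (F s) u) t.

Definition critical (t : R) : set 'cV[R]_n.+1 :=
  [set u | grad (F t) u = 0].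

Definition F0 : Prop :=
  [/\ {within I `*` setT, continuous (fun p : R * 'cV[R]_n.+1 => F p.1 p.2)},
      forall t u, I t ->
        derivable_within I (fun s => F s u) t /\ differentiable (F t) u,
      {within I `*` setT, continuous (fun p : R * 'cV[R]_n.+1 => dt_F p.1 p.2)}
    & {within I `*` setT,
        continuous (fun p : R * 'cV[R]_n.+1 => grad (F p.1) p.2)}].

Definition F1 : Prop :=
  forall rho : R, 0 < rho ->
    bounded_set [set u : 'cV[R]_n.+1 |
      (ereal_sup [set (`|F t u|)%:E | t in I] <= rho%:E)%E].

Definition F2 : Prop :=
  exists C1 C2 : R, [/\ 0 < C1, 0 < C2
    & forall t u, I t -> `|dt_F t u| <= C1 * F t u + C2].

Definition F3 : Prop :=
  forall M : R, 0 < M ->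
    exists2 a : R -> R,
      (@lebesgue_measure R).-integrable `]0, T[ (EFin \o a)
    & forall t u, I t -> enorm u <= M ->
        derivable_within I (fun s => grad (F s) u) t /\
        enorm (dt_grad_F t u) <= a t.

Definition F4 : Prop :=
  (forall t, I t -> C2 (F t)) /\
  {within I `*` setT,
    continuous (fun p : R * 'cV[R]_n.+1 => hess (F p.1) p.2)}.

Definition F5 : Prop :=
  forall t, I t -> critical t `<=` isolated (critical t).

End Assumptions.

Section Sobolev.
Context {R : realType}.
Implicit Types (a b : R) (f g phi : R -> R).
Local Notation mu := (@lebesgue_measure R).

(* phi is of class C^1 with compact support inside ]a, b[. *)
Definition test_function a b phi : Prop :=
  [/\ forall x, derivable phi x 1,
      continuous (derive1 phi),
      compact (closure [set x | phi x != 0])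
    & closure [set x | phi x != 0] `<=` `]a, b[].

Definition L2 a b f : Prop :=
  measurable_fun `]a, b[ f /\
  mu.-integrable `]a, b[ (fun x => (f x ^+ 2)%:E).

Definition weak_derivative a b f g : Prop :=
  forall phi, test_function a b phi ->
    \int[mu]_(x in `]a, b[) (f x * derive1 phi x) =
    - \int[mu]_(x in `]a, b[) (g x * phi x).

(* f belongs to W^{1,2}(a, b) and g represents its weak derivative. *)
Definition W12 a b f g : Prop :=
  [/\ L2 a b f, L2 a b g & weak_derivative a b f g].

(* w belongs to W^{2,2}([a, b], R^n.+1), with first and second weak derivatives
   dw and ddw.  Continuity selects the continuous representatives of w and of
   its first derivative, so that their values at a and b are meaningful; ddw is
   an arbitrary representative. *)
Definition W22 (n : nat) a b (w dw ddw : R -> 'cV[R]_n.+1) : Prop :=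
  [/\ {within `[a, b], continuous w},
      {within `[a, b], continuous dw}
    & forall i, W12 a b (fun s => w s i 0) (fun s => dw s i 0) /\
                W12 a b (fun s => dw s i 0) (fun s => ddw s i 0)].

End Sobolev.

Section Cost.
Context {R : realType} {n : nat}.
Variables (A B : 'M[R]_n.+1) (f : 'cV[R]_n.+1 -> R).
Implicit Types (N : nat) (u : 'cV[R]_n.+1) (w dw ddw : R -> 'cV[R]_n.+1).

Definition admissible N u1 u2 w dw ddw : Prop :=
  [/\ W22 (- N%:R) N%:R w dw ddw,
      w (- N%:R) = u1, w N%:R = u2,
      dw (- N%:R) = 0 & dw N%:R = 0].

Definition lagrangian w dw ddw (s : R) : R :=
  qnorm (invmx B) (grad f (w s) + A *m ddw s) ^+ 2 + qnorm B (dw s) ^+ 2.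

Definition action N w dw ddw : \bar R :=
  ((2^-1)%:E * \int[@lebesgue_measure R]_(s in `[(- N%:R)%R, N%:R%R])
     (lagrangian w dw ddw s)%:E)%E.

(* The cost c_t is [cost A B (F t)].  The half-length N ranges over the positive
   integers, since W^{2,2}([-N, N]) presupposes a nondegenerate interval. *)
Definition cost u1 u2 : \bar R :=
  ereal_inf [set c | exists N w dw ddw,
    [/\ (0 < N)%N, admissible N u1 u2 w dw ddw & c = action N w dw ddw]].

End Cost.

(* Main.v *)
(** Write [E(x, q) = f x + <q, A q> / 2]. For an admissible [w] with residual
    [g = grad f(w) + A w'' + B w'], completing the square in the action and using
    [E(w, w')' = <g - B w', w'>] gives
      action = f u - f v + 1/2 int <g, B^-1 g>.
    Hence [c(u, v) = f u - f v] provides approximate solutions of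
    [A w'' + B w' + grad f(w) = 0], resting at [u] before and at [v] after a bounded
    time interval, with arbitrarily small residual in L^2, along which [E] is almost
    nonincreasing; (F1) and (F2) keep them in a fixed compact set.

    Pointwise ultralimits of such pseudo-orbits are genuine solutions on the whole
    line. Translating time so that time 0 is the exit from a small ball around [u],
    the limit is a solution which stays near [u] in the past. By LaSalle's argument
    and the isolation of critical points it tends to [u] at -oo and to a critical
    point [u'] at +oo with [f u' < f u]. Cutting the approximating pseudo-orbits
    where they pass near [u'], and jumping there from rest at [u'], shows that
    pseudo-orbits also join [u'] to [v], so one can iterate. The iteration stops
    because a compact set contains only finitely many critical points. *)

Require Import Defs.
From HB Require Import structures.
From mathcomp Require Import all_boot all_order all_algebra.
From mathcomp Require Import all_classical all_reals all_analysis.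
From mathcomp Require Import measurable_realfun ring lra.

Set Implicit Arguments.
Unset Strict Implicit.
Unset Printing Implicit Defensive.

Import Order.TTheory GRing.Theory Num.Theory.
Import numFieldNormedType.Exports.

Local Open Scope classical_set_scope.
Local Open Scope ring_scope.

(** A pseudo-orbit tracks position and velocity separately and is subject only to closed
    inequalities in the values at one or two times. Such inequalities pass to pointwise ultralimits,
    for whose existence compactness of a ball suffices; regularity reappears when the error is zero,
    since the common modulus then forces differentiability. Jumps are allowed for the sake of the
    iteration: a pseudo-orbit can be cut near a rest point and glued to rest without any smoothing.
    The modulus and the bound must be fixed before the error. They come from a single energy
    sublevel. Its boundedness is not immediate from (F1), which needs control of F at all times:
    (F2), by a Gronwall estimate, propagates the control from time t. Each link of the chain
    strictly lowers f: an orbit of constant energy rests at a critical point, whereas the extracted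
    orbit is at time 0 on a small sphere free of critical points. The same strict descent makes the
    points of the chain distinct. *)

Section Ultralimits.
Context {I : Type}.
Implicit Types (T : topologicalType) (U : set_system I).

(** Compactness gives a cluster point; an ultrafilter decides every neighbourhood, so clustering is
    convergence. *)
Lemma ultra_cvg_in_compact T U (K : set T) (h : I -> T) :
  UltraFilter U -> compact K -> (forall i, K (h i)) ->
  exists2 l, K l & h i @[i --> U] --> l.
Proof.
move=> UU Kc Kh.
have hK : (h i @[i --> U]) K by rewrite /= nbhs_filterE; apply: filterE.
have [l [Kl cl]] := Kc _ _ hK.
exists l => // N Nl.
have [//|UN] := in_ultra_setVsetC (h @^-1` N) UU.
by have [x [/= xN Nx]] := cl (~` N) N UN Nl.
Qed.

(** If the preimage of a neighbourhood is not in [U], the trace of [U] on its complement is proper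
    and extends to an ultrafilter contradicting the hypothesis. Convergence thus reduces to
    identifying ultralimits. *)
Lemma cvg_ultra T U (h : I -> T) (l : T) : Filter U ->
  (forall G, UltraFilter G -> U `<=` G -> h i @[i --> G] --> l) ->
  h i @[i --> U] --> l.
Proof.
move=> FU hG N Nl; apply: contrapT => nUN.
have PW : ProperFilter (within (~` (h @^-1` N)) U).
  apply: Build_ProperFilter => W0; apply: nUN.
  rewrite /= /fmap /within /= in W0 *.
  apply: filterS W0 => i /= Hi; apply: contrapT => Ni; exact: Hi.
have [G [UG sG]] := ultraFilterLemma PW.
have GN : G (h @^-1` N).
  apply: (hG G UG) => // A UA; apply: sG; rewrite /within /=; exact: filterS UA.
have GnN : G (~` (h @^-1` N)) by apply: sG; rewrite /within /=; exact: filterE.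
by have /filter_ex [i []] : G (h @^-1` N `&` ~` (h @^-1` N)) by exact: filterI.
Qed.

End Ultralimits.

(** * Matrices with the entrywise sup norm *)

Section MatrixTopology.
Context {R : realType}.

Lemma mx_norm_le m n (x : 'M[R]_(m, n)) (c : R) :
  0 <= c -> (forall i j, `|x i j| <= c) -> `|x| <= c.
Proof.
move=> c0 xc; rewrite [leLHS]/Num.norm/= mx_normrE.
by apply/bigmax_leP; split => // -[i j] _; exact: xc.
Qed.

Lemma coord_le_mx_norm m n (x : 'M[R]_(m, n)) i j : `|x i j| <= `|x|.
Proof.
rewrite [leRHS]/Num.norm/= mx_normrE; apply/bigmax_geP; right => /=.
by exists (i, j).
Qed.

Lemma cvg_mxP (I : Type) (G : set_system I) m n
    (h : I -> 'M[R]_(m, n)) (l : 'M[R]_(m, n)) :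
  Filter G -> (forall i j, h k i j @[k --> G] --> (l i j : R)) ->
  h k @[k --> G] --> l.
Proof.
move=> FG hl; apply/cvgrPdist_le => e e0.
have H i j : \forall k \near G, `|l i j - h k i j| <= e.
  by have /cvgrPdist_le := hl i j; apply.
have /filter_forall H2 : forall i, G [set k | forall j, `|l i j - h k i j| <= e].
  by move=> i; apply: filter_forall => j; exact: H.
apply: filterS H2 => k Hk; apply: mx_norm_le; first exact: ltW.
by move=> i j; rewrite !mxE; exact: Hk.
Qed.

(** The factor [n%:R] counts the terms in an entry of the product; the sup norm is not
    submultiplicative. *)
Lemma mulmx_norm_le m n p (A : 'M[R]_(m, n)) (x : 'M[R]_(n, p)) :
  `|A *m x| <= n%:R * `|A| * `|x|.
Proof.
apply: mx_norm_le; first by rewrite !mulr_ge0.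
move=> i j; rewrite mxE; apply: le_trans (ler_norm_sum _ _ _) _.
rewrite -mulrA mulr_natl.
have -> : `|A| * `|x| *+ n = \sum_(k < n) `|A| * `|x| by rewrite sumr_const card_ord.
apply: ler_sum => k _; rewrite normrM.
by apply: ler_pM => //; exact: coord_le_mx_norm.
Qed.

Lemma near_dist_le (V : normedModType R) (x : V) (e : R) : 0 < e ->
  \forall y \near x, `|x - y| <= e.
Proof. by move=> e0; have /cvgrPdist_le := @cvg_id _ (nbhs x); exact. Qed.

Lemma mulmx_continuous m n p (A : 'M[R]_(m, n)) :
  continuous (fun x : 'M[R]_(n, p) => A *m x).
Proof.
move=> x; have Fx : Filter (nbhs x) := nbhs_filter x.
apply/cvgrPdist_le => e e0.
have k0 : 0 < n%:R * `|A| + 1 by rewrite ltr_wpDl// mulr_ge0.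
have H : \forall y \near x, `|x - y| <= e / (n%:R * `|A| + 1).
  by apply: (@near_dist_le 'M[R]_(n, p)); exact: divr_gt0.
apply: filterS H => y; rewrite -mulmxBr ler_pdivlMr// => xy.
apply: le_trans (mulmx_norm_le _ _) _; apply: le_trans xy.
by rewrite mulrC ler_wpM2l// lerDl.
Qed.

Lemma col_ball_compact n (M : R) : compact [set x : 'cV[R]_n | `|x| <= M].
Proof.
have : compact [set x : 'rV[R]_n | `|x| <= M].
  apply: bounded_closed_compact.
    by exists M; split; [exact: num_real|move=> c Mc x /= /le_trans; apply; exact: ltW].
  have -> : [set x : 'rV[R]_n | `|x| <= M] = (@Num.norm _ _) @^-1` [set y | y <= M] by [].
  apply: closed_comp; last exact: closed_le.
  by move=> x _; exact: norm_continuous.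
move=> /(@continuous_compact _ _ (fun x : 'rV[R]_n => x^T : 'cV[R]_n)) H.
have normT (m p : nat) (x : 'M[R]_(m, p)) : `|x^T| <= `|x|.
  by apply: mx_norm_le => // i j; rewrite mxE; exact: coord_le_mx_norm.
have -> : [set x : 'cV[R]_n | `|x| <= M] =
          (fun x : 'rV[R]_n => x^T : 'cV[R]_n) @` [set x | `|x| <= M].
  apply/seteqP; split => [x /= xM|_ [x /= xM <-]].
    by exists (x^T); [exact: le_trans (normT _ _ _) xM|rewrite trmxK].
  exact: le_trans (normT _ _ _) xM.
apply: H; apply: continuous_subspaceT => x.
apply: (cvg_mxP (nbhs_filter x)) => i j; rewrite [X in _ --> X]mxE.
under eq_fun do rewrite mxE.
exact: coord_continuous.
Qed.

End MatrixTopology.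

(** * The inner product and positive definite forms *)

Section QuadraticForms.
Context {R : realType} {n : nat}.
Local Notation X := 'cV[R]_n.+1.
Implicit Types (x y z : X) (Q : 'M[R]_n.+1) (c : R).

Lemma dotC x y : dot x y = dot y x.
Proof. by apply: eq_bigr => i _; rewrite mulrC. Qed.

Lemma dotDl x y z : dot (x + y) z = dot x z + dot y z.
Proof. by rewrite -big_split; apply: eq_bigr => i _; rewrite !mxE mulrDl. Qed.

Lemma dotZl c x y : dot (c *: x) y = c * dot x y.
Proof. by rewrite mulr_sumr; apply: eq_bigr => i _; rewrite !mxE mulrA. Qed.

Lemma dotNl x y : dot (- x) y = - dot x y.
Proof. by rewrite -scaleN1r dotZl mulN1r. Qed.

Lemma dotDr x y z : dot x (y + z) = dot x y + dot x z.
Proof. by rewrite dotC dotDl !(dotC x). Qed.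

Lemma dotZr c x y : dot x (c *: y) = c * dot x y.
Proof. by rewrite dotC dotZl (dotC x). Qed.

Lemma dotNr x y : dot x (- y) = - dot x y.
Proof. by rewrite dotC dotNl (dotC x). Qed.

Lemma dot0l x : dot 0 x = 0.
Proof. by rewrite -[0](scale0r 0) dotZl mul0r. Qed.

Lemma dot0r x : dot x 0 = 0.
Proof. by rewrite dotC dot0l. Qed.

Lemma dot_delta x i : dot x (delta_mx i 0) = x i 0.
Proof.
rewrite /dot (bigD1 i)//= mxE !eqxx mulr1 big1 ?addr0// => j /negbTE ji.
by rewrite mxE ji mulr0.
Qed.

Lemma dot_mulmx Q x y : dot x (Q *m y) = dot (Q^T *m x) y.
Proof.
have dotE a b : dot a b = (a^T *m b) 0 0.
  by rewrite mxE; apply: eq_bigr => i _; rewrite mxE.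
by rewrite !dotE trmx_mul trmxK mulmxA.
Qed.

Lemma cvg_dot (I : Type) (G : set_system I) (h k : I -> X) x y :
  Filter G -> h i @[i --> G] --> x -> k i @[i --> G] --> y ->
  dot (h i) (k i) @[i --> G] --> dot x y.
Proof.
move=> FG hx ky; apply: cvg_big.
  exact: add_continuous.
move=> i _; apply: cvgM.
  by apply: (@cvg_comp _ _ _ h (fun M : X => M i 0) _ _ _ hx); exact: coord_continuous.
by apply: (@cvg_comp _ _ _ k (fun M : X => M i 0) _ _ _ ky); exact: coord_continuous.
Qed.

Section Posdef.
Variable Q : 'M[R]_n.+1.
Hypothesis Qpd : sym_posdef Q.

Lemma posdef_dotC x y : dot x (Q *m y) = dot y (Q *m x).
Proof. by rewrite dot_mulmx Qpd.1 dotC. Qed.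

Lemma posdef_ge0 x : 0 <= dot x (Q *m x).
Proof.
by have [->|/Qpd.2/ltW//] := eqVneq x 0; rewrite dot0l.
Qed.

Lemma posdef_eq0 x : dot x (Q *m x) = 0 -> x = 0.
Proof.
by move=> x0; apply/eqP/negP => /negP /Qpd.2; rewrite x0 ltxx.
Qed.

Lemma posdef_cauchy_schwarz x y :
  dot x (Q *m y) ^+ 2 <= dot x (Q *m x) * dot y (Q *m y).
Proof.
have [->|y0] := eqVneq y 0; first by rewrite mulmx0 dot0r dot0l expr0n mulr0.
have c0 := Qpd.2 y y0.
set a := dot x (Q *m x); set b := dot x (Q *m y); set c := dot y (Q *m y).
(* The form at this vector expands to [c * (a * c - b ^+ 2)], and [c] is positive. *)
have := posdef_ge0 (c *: x - b *: y).
rewrite mulmxBr -!scalemxAr !(dotDl, dotDr, dotNl, dotNr, dotZl, dotZr).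
rewrite (posdef_dotC y x) -/a -/b -/c => H.
have : 0 <= c * (a * c - b ^+ 2).
  by apply: le_trans H _; rewrite le_eqVlt; apply/orP; left; apply/eqP; ring.
by rewrite pmulr_rge0// subr_ge0.
Qed.

(** A row of the left kernel is, by symmetry and after transposition, a vector killed by [Q];
    definiteness makes it zero. *)
Lemma posdef_unitmx : Q \in unitmx.
Proof.
rewrite -row_free_unit -kermx_eq0; apply/eqP/row_matrixP => i.
rewrite row0; apply: trmx_inj; rewrite trmx0; apply: posdef_eq0.
have -> : Q *m (row i (kermx Q))^T = 0.
  rewrite -{1}Qpd.1 -trmx_mul; have /sub_kermxP -> := row_sub i (kermx Q).
  by rewrite trmx0.
by rewrite dot0r.
Qed.

Lemma posdef_invmx : sym_posdef (invmx Q).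
Proof.
split; first by rewrite trmx_inv Qpd.1.
move=> x x0; have xE : x = Q *m (invmx Q *m x) by rewrite mulKVmx ?posdef_unitmx.
rewrite {1}xE dotC; apply: Qpd.2; apply: contra_neq x0 => x0.
by rewrite xE x0 mulmx0.
Qed.

(** Cauchy-Schwarz against [invmx Q *m delta_mx i 0], whose image under [Q] picks out the
    coordinate. *)
Lemma posdef_coord_le x i : x i 0 ^+ 2 <= invmx Q i i * dot x (Q *m x).
Proof.
have := posdef_cauchy_schwarz x (invmx Q *m delta_mx i 0).
rewrite mulKVmx ?posdef_unitmx// !dot_delta mulrC; congr (_ <= _ * _).
by rewrite -colE mxE.
Qed.

Lemma posdef_norm_le x : `|x| ^+ 2 <= `|invmx Q| * dot x (Q *m x).
Proof.
have q0 := posdef_ge0 x.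
have c0 : 0 <= `|invmx Q| * dot x (Q *m x) by rewrite mulr_ge0.
rewrite -[leRHS]sqr_sqrtr// ler_sqr ?nnegrE ?sqrtr_ge0//.
apply: mx_norm_le; first exact: sqrtr_ge0.
move=> i j; rewrite ord1 -sqrtr_sqr; apply: ler_wsqrtr.
apply: le_trans (posdef_coord_le _ _) _; apply: ler_wpM2r => //.
exact: le_trans (ler_norm _) (coord_le_mx_norm _ _ _).
Qed.

Lemma sqr_qnorm x : qnorm Q x ^+ 2 = dot x (Q *m x).
Proof. by rewrite sqr_sqrtr// posdef_ge0. Qed.

End Posdef.
End QuadraticForms.

(** * Differential calculus along curves *)

Section Derivatives.
Context {R : realType}.

Lemma is_derive_increments (V : normedModType R) (y : R -> V) (s : R) (d : V) :
  (forall e, 0 < e -> \forall t \near s, `|y t - y s - (t - s) *: d| <= e * `|t - s|) ->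
  is_derive s 1 y d.
Proof.
move=> yd.
have cv : (h^-1 *: ((y \o shift s) (h *: 1) - y s)) @[h --> 0^'] --> d.
  apply/cvgrPdist_le => e e0.
  have /nbhs_ballP[r r0 H] := yd e e0.
  exists r => //= h; rewrite /ball_/= sub0r normrN => hr h0.
  have {}H : `|y (h + s) - y s - h *: d| <= e * `|h|.
    have := H (h + s); rewrite /ball/= opprD addrCA subrr addr0 normrN addrK.
    exact.
  rewrite [h *: 1]mulr1 -[d in d - _](scalerK h0) -scalerBr normrZ normfV.
  rewrite ler_pdivrMl ?normr_gt0// -normrN opprB.
  by rewrite mulrC.
by apply: DeriveDef; [apply/cvg_ex; exists d|exact: cvg_lim].
Qed.

Lemma is_derive_mxP m n (M : R -> 'M[R]_(m, n)) (s : R) (D : 'M[R]_(m, n)) :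
  is_derive s 1 M D <->
  forall i j, is_derive s 1 (fun t => M t i j) (D i j).
Proof.
split=> [[dM <-] i j|dM].
  have /derivable_mxP dMij := dM; rewrite derive_mx// mxE.
  exact/derivableP.
have dd : derivable M s 1 by apply/derivable_mxP => i j; exact: ex_derive.
apply: DeriveDef => //; rewrite derive_mx//; apply/matrixP => i j.
by rewrite mxE; exact: derive_val.
Qed.

Lemma is_derive_fsum n (h : 'I_n -> R -> R) (s : R) (dh : 'I_n -> R) :
  (forall i, is_derive s 1 (h i) (dh i)) ->
  is_derive s 1 (fun t => \sum_(i < n) h i t) (\sum_(i < n) dh i).
Proof.
move=> H; have := is_derive_sum H.
by congr (is_derive _ _ _ _); apply/funext => t; rewrite fct_sumE.
Qed.

Lemma is_derive_mulmx m n p (A : 'M[R]_(m, n)) (M : R -> 'M[R]_(n, p)) (s : R) D :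
  is_derive s 1 M D -> is_derive s 1 (fun t => A *m M t) (A *m D).
Proof.
move=> /is_derive_mxP dM; apply/is_derive_mxP => i j; rewrite mxE.
under eq_fun do rewrite mxE.
exact: is_derive_fsum.
Qed.

Lemma is_derive_dot n (p q : R -> 'cV[R]_n.+1) (s : R) dp dq :
  is_derive s 1 p dp -> is_derive s 1 q dq ->
  is_derive s 1 (fun t => dot (p t) (q t)) (dot dp (q s) + dot (p s) dq).
Proof.
move=> /is_derive_mxP dP /is_derive_mxP dQ; rewrite -big_split/=.
apply: is_derive_fsum => k; have := is_deriveM (dP k 0) (dQ k 0).
by move/is_derive_eq; apply; rewrite addrC; congr (_ + _); rewrite mulrC.
Qed.

Lemma derive_gradE n (f : 'cV[R]_n.+1 -> R) x v :
  differentiable f x -> 'D_v f x = dot (grad f x) v.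
Proof.
move=> df; rewrite deriveE// {1}[v]matrix_sum_delta linear_sum/=.
apply: eq_bigr => i _; rewrite big_ord1 linearZ/= mxE deriveE// mulrC.
by [].
Qed.

Lemma is_derive_comp_grad n (f : 'cV[R]_n.+1 -> R) (w : R -> 'cV[R]_n.+1) (s : R) d :
  differentiable f (w s) -> is_derive s 1 w d ->
  is_derive s 1 (fun t => f (w t)) (dot (grad f (w s)) d).
Proof.
move=> df [dw dwE].
have dw' : differentiable w s by exact/derivable1_diffP.
have dfw : differentiable (f \o w) s by exact: differentiable_comp.
apply: DeriveDef; first exact/derivable1_diffP.
rewrite deriveE// diff_comp//=.
have -> : 'd w s 1 = d by rewrite -dwE deriveE.
by rewrite -deriveE// derive_gradE.
Qed.

End Derivatives.

(** * Regularity from increments taken forward in time *)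

Section OneSidedIncrements.
Context {R : realType} {V : normedModType R}.
Implicit Types (y d : R -> V).

(** For [t < s] the bound is used with base point [t], which works because [r] and [C] are uniform
    in the base point. *)
Lemma continuous_one_sided_lipschitz y (r C : R) : 0 < r ->
  (forall s t, s <= t <= s + r -> `|y t - y s| <= C * (t - s)) -> continuous y.
Proof.
move=> r0 yC s; apply/cvgrPdist_le => e e0.
have C1 : 0 < `|C| + 1 by rewrite ltr_wpDl.
have m0 : 0 < Num.min r (e / (`|C| + 1)) by rewrite lt_min r0 divr_gt0.
have H := @near_dist_le _ R^o s _ m0.
apply: filterS H => t; rewrite le_min => /andP[str]; rewrite ler_pdivlMr// => ste.
have {}ste : C * `|s - t| <= e.
  apply: le_trans ste; rewrite mulrC ler_wpM2l//.
  by apply: le_trans (ler_norm _) _; rewrite lerDl.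
have [st|/ltW ts] := leP s t.
  move: str ste; rewrite distrC ger0_norm ?subr_ge0// => str ste.
  rewrite distrC; apply: le_trans (yC _ _ _) ste.
  by rewrite st/=; lra.
move: str ste; rewrite ger0_norm ?subr_ge0// => str ste.
apply: le_trans (yC _ _ _) ste.
by rewrite ts/=; lra.
Qed.

Lemma is_derive_one_sided y d : continuous d ->
  (forall e, 0 < e -> exists2 r, 0 < r & forall s t, s <= t <= s + r ->
    `|y t - y s - (t - s) *: d s| <= e * (t - s)) ->
  forall s : R, is_derive s 1 y (d s).
Proof.
move=> dc yd s; apply: is_derive_increments => e e0.
have e20 : 0 < e / 2 by rewrite divr_gt0.
have [r r0 H] := yd _ e20.
have N1 : \forall t \near s, `|s - t| <= r by exact: (@near_dist_le _ R^o).
have N2 : \forall t \near s, `|d s - d t| <= e / 2.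
  by have /cvgrPdist_le := dc s; exact.
near=> t.
have t1 : `|s - t| <= r by near: t.
have t2 : `|d s - d t| <= e / 2 by near: t.
have [st|/ltW ts] := leP s t.
  move: t1; rewrite distrC ger0_norm ?subr_ge0// => t1.
  apply: le_trans (H _ _ _) _; first by rewrite st/=; lra.
  by rewrite ler_wpM2r ?subr_ge0//; lra.
move: t1; rewrite (distrC t) ger0_norm ?subr_ge0// => t1.
(* Backward increment: the estimate based at [t] has slope [d t], and continuity of [d] pays for
   replacing it by [d s]. Each error takes half of [e]. *)
have -> : y t - y s - (t - s) *: d s =
   (s - t) *: (d s - d t) - (y s - y t - (s - t) *: d t).
  rewrite scalerBr -[t - s]opprB scaleNr opprK.
  by rewrite [in RHS]opprB addrA subrK opprB addrC.
apply: le_trans (ler_normB _ _) _.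
rewrite normrZ (ger0_norm (_ : 0 <= s - t)) ?subr_ge0//.
have H' : `|y s - y t - (s - t) *: d t| <= e / 2 * (s - t).
  by apply: H; rewrite ts/=; lra.
have st0 : 0 <= s - t by rewrite subr_ge0.
have := ler_wpM2l st0 t2; lra.
Unshelve. all: by end_near. Qed.

End OneSidedIncrements.

Lemma ultra_le {I : Type} {R : realType} (U : set_system I) (h k : I -> R) (a b : R) :
  ProperFilter U -> h i @[i --> U] --> a -> k i @[i --> U] --> b ->
  (forall i, h i <= k i) -> a <= b.
Proof.
move=> PU ha kb hk; rewrite -subr_le0.
apply: (cvgr_to_le (cvgB ha kb)); apply: filterE => i.
by rewrite subr_le0.
Qed.

(** * Pseudo-orbits, their limits, and the energy of orbits *)

Section PseudoOrbits.
Context {R : realType} {n : nat}.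
Local Notation X := 'cV[R]_n.+1.
Variables (A B : 'M[R]_n.+1) (f : X -> R) (rho : R -> R) (M : R).

Definition energy (x q : X) : R := f x + 2^-1 * dot q (A *m q).

(** The equation of motion reads [A p' = - force w p], where [p] is the velocity. *)
Definition force (x q : X) : X := B *m q + grad f x.

(* Both equations of motion hold up to [dl] plus an error of order [e (t - s)] on
   intervals of length [rho e]. No continuity is required, so jumps of size [dl]
   are allowed. The modulus [rho] is shared by all pseudo-orbits of a family,
   which makes the definition stable under pointwise limits; for [dl = 0] it
   characterises the solutions. *)
Definition pseudo_orbit (dl : R) (w p : R -> X) : Prop :=
  [/\ forall s, `|w s| <= M, forall s, `|p s| <= M,
      forall s t, s <= t -> energy (w t) (p t) <= energy (w s) (p s) + dl
    & forall e s t, 0 < e -> s <= t <= s + rho e ->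
      `|w t - w s - (t - s) *: p s| <= e * (t - s) + dl /\
      `|A *m (p t - p s) + (t - s) *: force (w s) (p s)| <= e * (t - s) + dl].

Hypotheses (A_spd : sym_posdef A) (B_spd : sym_posdef B).
Hypothesis f_diff : forall x, differentiable f x.
Hypothesis gradf_cont : continuous (grad f).
Hypothesis rho_gt0 : forall e, 0 < e -> 0 < rho e.

Lemma cvg_f (I : Type) (G : set_system I) (h : I -> X) x :
  Filter G -> h i @[i --> G] --> x -> f (h i) @[i --> G] --> f x.
Proof.
move=> FG hx; apply: (@cvg_comp _ _ _ h f _ _ _ hx).
exact: (differentiable_continuous (f_diff x)).
Qed.

Lemma cvg_gradf (I : Type) (G : set_system I) (h : I -> X) x :
  Filter G -> h i @[i --> G] --> x -> grad f (h i) @[i --> G] --> grad f x.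
Proof.
by move=> FG hx; apply: (@cvg_comp _ _ _ h (grad f) _ _ _ hx); exact: gradf_cont.
Qed.

Lemma cvg_mulmxl (I : Type) (G : set_system I) (Q : 'M[R]_n.+1) (h : I -> X) x :
  Filter G -> h i @[i --> G] --> x -> Q *m h i @[i --> G] --> Q *m x.
Proof.
by move=> FG hx; apply: (@cvg_comp _ _ _ h (mulmx Q) _ _ _ hx); exact: mulmx_continuous.
Qed.

Lemma cvg_energy (I : Type) (G : set_system I) (h k : I -> X) x q :
  Filter G -> h i @[i --> G] --> x -> k i @[i --> G] --> q ->
  energy (h i) (k i) @[i --> G] --> energy x q.
Proof.
move=> FG hx kq; apply: cvgD; first exact: cvg_f.
apply: cvgMr; apply: cvg_dot => //; exact: cvg_mulmxl.
Qed.

Lemma cvg_force (I : Type) (G : set_system I) (h k : I -> X) x q :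
  Filter G -> h i @[i --> G] --> x -> k i @[i --> G] --> q ->
  force (h i) (k i) @[i --> G] --> force x q.
Proof.
by move=> FG hx kq; apply: cvgD; [exact: cvg_mulmxl|exact: cvg_gradf].
Qed.

(** Values stay in the ball of radius [M], so ultralimits exist at every time; both sides of each
    inequality are continuous in the values involved, and [dl] tends to 0. *)
Lemma pseudo_orbit_limit (I : Type) (U : set_system I) (dl : I -> R)
    (w p : I -> R -> X) :
  UltraFilter U -> dl i @[i --> U] --> (0 : R) ->
  (forall i, pseudo_orbit (dl i) (w i) (p i)) ->
  exists w' p' : R -> X,
    [/\ forall s, w i s @[i --> U] --> w' s, forall s, p i s @[i --> U] --> p' s
      & pseudo_orbit 0 w' p'].
Proof.
move=> UU dl0 wp.
have ex (h : I -> R -> X) : (forall i s, `|h i s| <= M) ->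
    exists2 h' : R -> X, (forall s, `|h' s| <= M) & forall s, h i s @[i --> U] --> h' s.
  move=> hM; have /choice[h' Hh'] : forall s, exists l : X,
      `|l| <= M /\ h i s @[i --> U] --> l.
    move=> s; have [l lM hl] :=
      ultra_cvg_in_compact UU (@col_ball_compact R n.+1 M) (hM^~ s).
    by exists l.
  by exists h' => s; have [] := Hh' s.
have [w' w'M ww'] := ex w (fun i => let: And4 H _ _ _ := wp i in H).
have [p' p'M pp'] := ex p (fun i => let: And4 _ H _ _ := wp i in H).
exists w', p'; split => //; split => //.
- move=> s t st; apply: (@ultra_le I R U (fun i => energy (w i t) (p i t))
     (fun i => energy (w i s) (p i s) + dl i)).
  + exact: cvg_energy.
  + by apply: cvgD => //; exact: cvg_energy.
  + by move=> i; have [_ _ H _] := wp i; exact: H.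
- move=> e s t e0 st; split.
  + apply: (@ultra_le I R U (fun i => `|w i t - w i s - (t - s) *: p i s|)
      (fun i => e * (t - s) + dl i)).
    * by apply: cvg_norm; apply: cvgB; [exact: cvgB|exact: cvgZr].
    * by apply: cvgD => //; exact: cvg_cst.
    * by move=> i; have [_ _ _ H] := wp i; have [] := H e s t e0 st.
  + apply: (@ultra_le I R U
       (fun i => `|A *m (p i t - p i s) + (t - s) *: force (w i s) (p i s)|)
       (fun i => e * (t - s) + dl i)).
    * apply: cvg_norm; apply: cvgD; first by apply: cvg_mulmxl; exact: cvgB.
      by apply: cvgZr; exact: cvg_force.
    * by apply: cvgD => //; exact: cvg_cst.
    * by move=> i; have [_ _ _ H] := wp i; have [] := H e s t e0 st.
Qed.

Lemma force_bounded : exists K, forall x q, `|x| <= M -> `|q| <= M -> `|force x q| <= K.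
Proof.
have [M0|M0] := ltP M 0.
  by exists 0 => x q xM; have := le_lt_trans xM M0; rewrite normr_lt0.
have c : compact [set x : X | `|x| <= M] := @col_ball_compact R n.+1 M.
have ne : [set x : X | `|x| <= M] !=set0 by exists 0; rewrite /= normr0.
have cg : {within [set x : X | `|x| <= M], continuous (fun x : X => `|grad f x|)}.
  apply: continuous_subspaceT => x; apply: (@cvg_norm _ _ _ (nbhs x)).
  exact: gradf_cont.
have [x0 _ Hx0] := compact_EVT_max ne c cg.
exists (n.+1%:R * `|B| * M + `|grad f x0|) => x q xM qM.
apply: le_trans (ler_normD _ _) _; apply: lerD.
  by apply: le_trans (mulmx_norm_le _ _) _; rewrite ler_wpM2l// mulr_ge0.
by apply: Hx0; rewrite inE.
Qed.

Section Orbit.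
Variables w p : R -> X.
Hypothesis wp : pseudo_orbit 0 w p.

(** With zero error, the second estimate at [e = 1] bounds increments of [A *m p] by
    [(K + 1) * (t - s)], where [K] bounds the force; inverting [A] gives continuity of [p]. *)
Lemma orbit_momentum_continuous : continuous p.
Proof.
have [wM pM _ H] := wp; have [K HK] := force_bounded.
have -> : p = (fun s => invmx A *m (A *m p s)).
  by apply/funext => s; rewrite mulKmx// posdef_unitmx.
move=> s; apply: cvg_mulmxl.
apply: (@continuous_one_sided_lipschitz _ _ _ (rho 1) (K + 1)); first exact: rho_gt0.
move=> {}s t st; have [_ {}H] := H 1 s t ltr01 st.
have st0 : 0 <= t - s by rewrite subr_ge0; case/andP: st.
rewrite -mulmxBr -[X in `|X|](addrK ((t - s) *: force (w s) (p s))).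
apply: le_trans (ler_normB _ _) _.
rewrite normrZ (ger0_norm st0).
have := ler_wpM2l st0 (HK _ _ (wM s) (pM s)); lra.
Qed.

Lemma orbit_velocity (s : R) : is_derive s 1 w (p s).
Proof.
have [wM pM _ H] := wp.
apply: is_derive_one_sided; first exact: orbit_momentum_continuous.
move=> e e0; exists (rho e); first exact: rho_gt0.
by move=> {}s t st; have [] := H e s t e0 st; rewrite addr0.
Qed.

Lemma orbit_position_continuous : continuous w.
Proof.
move=> s; apply: differentiable_continuous; apply/derivable1_diffP.
by have [] := orbit_velocity s.
Qed.

Lemma orbit_acceleration (s : R) : is_derive s 1 p (- (invmx A *m force (w s) (p s))).
Proof.
have [wM pM _ H] := wp.
have -> : p = (fun s => invmx A *m (A *m p s)).
  by apply/funext => t; rewrite mulKmx// posdef_unitmx.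
rewrite -mulmxN; apply: is_derive_mulmx; rewrite mulKmx ?posdef_unitmx//.
apply: (@is_derive_one_sided _ _ _ (fun s => - force (w s) (p s))).
  move=> t; apply: cvgN; apply: cvg_force; first exact: orbit_position_continuous.
  exact: orbit_momentum_continuous.
move=> e e0; exists (rho e); first exact: rho_gt0.
move=> {}s t st; have [_] := H e s t e0 st.
by rewrite addr0 mulmxBr scalerN opprK.
Qed.

(** The term [<grad f(w), p>] from the potential cancels against the one in [<p, A p'>], which
    leaves the friction. *)
Lemma orbit_energy_derive (s : R) :
  is_derive s 1 (fun t => energy (w t) (p t)) (- dot (p s) (B *m p s)).
Proof.
have dw := orbit_velocity s; have dp := orbit_acceleration s.
have d1 := is_derive_comp_grad (f_diff (w s)) dw.
have d2 := is_derive_dot dp (is_derive_mulmx A dp).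
have d3 := @is_deriveZ _ _ _ _ (2^-1) _ _ _ d2.
have := is_deriveD d1 d3; move/is_derive_eq; apply.
rewrite -(posdef_dotC A_spd) mulmxN mulKVmx ?posdef_unitmx// -mulr2n.
have Z (a : R) : 2^-1 *: (a *+ 2 : R^o) = a.
  by change (2^-1 * (a *+ 2) = a); field.
by rewrite [X in _ + X]Z dotNr dotDr (dotC (grad f (w s))); ring.
Qed.

(** Zero dissipation forces [p = 0] by definiteness of [B]; the acceleration then vanishes and the
    equation of motion leaves only the gradient. *)
Lemma orbit_const_energy (L : R) : (forall s, energy (w s) (p s) = L) ->
  forall s, p s = 0 /\ grad f (w s) = 0.
Proof.
move=> EL.
have p0 s : p s = 0.
  apply: (posdef_eq0 B_spd).
  have [_ d1] := orbit_energy_derive s.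
  have E : (fun t => energy (w t) (p t)) = cst L by apply/funext.
  by rewrite -[LHS]opprK -d1 E derive_cst oppr0.
move=> s; split => //.
have [_ d1] := orbit_acceleration s.
have E : p = cst 0 by apply/funext.
move: d1; rewrite E derive_cst /force mulmx0 add0r => /esym/eqP.
rewrite oppr_eq0 => /eqP H.
by rewrite -(mulKVmx (posdef_unitmx A_spd) (grad f (w s))) H mulmx0.
Qed.

End Orbit.
End PseudoOrbits.

(** * Limits of orbits at infinity and descent through critical points *)

Section HeteroclinicChains.
Context {R : realType} {n : nat}.
Local Notation X := 'cV[R]_n.+1.
Variables (A B : 'M[R]_n.+1) (f : X -> R) (rho : R -> R) (M : R).
Hypotheses (A_spd : sym_posdef A) (B_spd : sym_posdef B).
Hypothesis f_diff : forall x, differentiable f x.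
Hypothesis gradf_cont : continuous (grad f).
Hypothesis rho_gt0 : forall e, 0 < e -> 0 < rho e.
Hypothesis rho_le1 : forall e, rho e <= 1.
Hypothesis crit_isolated : forall x, grad f x = 0 ->
  exists2 r, 0 < r & forall y, `|y - x| <= r -> grad f y = 0 -> y = x.

Local Notation energy := (energy A f).
Local Notation force := (force B f).
Local Notation pseudo_orbit := (pseudo_orbit A B f rho M).
Local Notation oo_p := (pinfty_nbhs R).
Local Notation oo_n := (ninfty_nbhs R).

Lemma pseudo_orbit_shift dl (w p : R -> X) (a : R) :
  pseudo_orbit dl w p -> pseudo_orbit dl (fun s => w (a + s)) (fun s => p (a + s)).
Proof.
move=> [wM pM E H]; split; [by move=> s; exact: wM|by move=> s; exact: pM| |].
- by move=> s t st; apply: E; rewrite lerD2l.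
- move=> e s t e0 st; have -> : t - s = a + t - (a + s) by ring.
  by apply: H => //; rewrite lerD2l -addrA lerD2l.
Qed.

Section Orbit.
Variables w p : R -> X.
Hypothesis wp : pseudo_orbit 0 w p.
Local Notation E s := (energy (w s) (p s)).

Lemma orbit_energy_le s t : s <= t -> E t <= E s.
Proof. by move=> st; have [_ _ + _] := wp => /(_ _ _ st); rewrite addr0. Qed.

Lemma orbit_ultralimit (U : set_system R) : UltraFilter U ->
  exists x q : X, [/\ `|x| <= M, w s @[s --> U] --> x & p s @[s --> U] --> q].
Proof.
move=> UU; have [wM pM _ _] := wp.
have [x xM wx] := ultra_cvg_in_compact UU (@col_ball_compact R n.+1 M) wM.
have [q qM pq] := ultra_cvg_in_compact UU (@col_ball_compact R n.+1 M) pM.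
by exists x, q.
Qed.

(** The energy is monotone, and along an ultrafilter finer than [+oo] it tends to the energy of a
    limit point, which is [L]. The limit is stated for translates, as LaSalle's argument uses it. *)
Lemma orbit_energy_pinfty :
  exists2 L, (forall s, L <= E s) & forall s, E (tau + s) @[tau --> oo_p] --> L.
Proof.
have [U [UU sU]] := ultraFilterLemma (@proper_pinfty_nbhs R).
have [x [q [_ wx pq]]] := orbit_ultralimit UU.
have EL : E s @[s --> U] --> energy x q by exact: cvg_energy.
have LE s : energy x q <= E s.
  apply: (cvgr_to_le EL); apply: sU; exists s; split; first exact: num_real.
  by move=> t /ltW st; exact: orbit_energy_le.
exists (energy x q) => // s; apply/cvgrPdist_le => e e0.
have : \forall t \near U, `|energy x q - E t| <= e by have /cvgrPdist_le := EL; exact.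
move=> /filter_ex[t]; rewrite distrC ger0_norm ?subr_ge0// => Ht.
exists (t - s); split; first exact: num_real.
move=> tau tt; rewrite /= distrC ger0_norm ?subr_ge0//.
apply: le_trans Ht; rewrite lerD2r; apply: orbit_energy_le; lra.
Qed.

Lemma orbit_energy_ninfty :
  exists2 L, (forall s, E s <= L) & forall s, E (tau + s) @[tau --> oo_n] --> L.
Proof.
have [U [UU sU]] := ultraFilterLemma (@proper_ninfty_nbhs R).
have [x [q [_ wx pq]]] := orbit_ultralimit UU.
have EL : E s @[s --> U] --> energy x q by exact: cvg_energy.
have LE s : E s <= energy x q.
  apply: (cvgr_to_ge EL); apply: sU; exists s; split; first exact: num_real.
  by move=> t /ltW st; exact: orbit_energy_le.
exists (energy x q) => // s; apply/cvgrPdist_le => e e0.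
have : \forall t \near U, `|energy x q - E t| <= e by have /cvgrPdist_le := EL; exact.
move=> /filter_ex[t]; rewrite ger0_norm ?subr_ge0// => Ht.
exists (t - s); split; first exact: num_real.
move=> tau tt; rewrite /= ger0_norm ?subr_ge0//.
apply: le_trans Ht; rewrite lerD2l lerN2; apply: orbit_energy_le; lra.
Qed.

(* LaSalle: a limit of translates of the orbit is an orbit of constant energy. *)
Lemma orbit_limit_rest (F U : set_system R) (L : R) (x q : X) :
  (forall s, E (tau + s) @[tau --> F] --> L) -> UltraFilter U -> F `<=` U ->
  w s @[s --> U] --> x -> p s @[s --> U] --> q -> q = 0 /\ grad f x = 0.
Proof.
move=> EL UU FU wx pq.
have dl0 : (fun _ : R => 0 : R) i @[i --> U] --> (0 : R) by exact: cvg_cst.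
have [w' [p' [ww' pp' o']]] := pseudo_orbit_limit f_diff gradf_cont UU dl0
  (fun tau => pseudo_orbit_shift tau wp).
have w'0 : w' 0 = x.
  apply: (cvg_unique (@norm_hausdorff _ _) (ww' 0)).
  by rewrite (_ : (fun i => w (i + 0)) = w)//; apply/funext => i; rewrite addr0.
have p'0 : p' 0 = q.
  apply: (cvg_unique (@norm_hausdorff _ _) (pp' 0)).
  by rewrite (_ : (fun i => p (i + 0)) = p)//; apply/funext => i; rewrite addr0.
have E' s : energy (w' s) (p' s) = L.
  have c1 : E (i + s) @[i --> U] --> energy (w' s) (p' s) by exact: cvg_energy.
  apply: (cvg_unique (@norm_hausdorff _ _) c1).
  by move=> N /(EL s) FN; exact: FU.
have := orbit_const_energy A_spd B_spd f_diff gradf_cont rho_gt0 o' E' 0.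
by rewrite w'0 p'0.
Qed.

Lemma orbit_momentum_vanish (F : set_system R) (L : R) : ProperFilter F ->
  (forall s, E (tau + s) @[tau --> F] --> L) -> p s @[s --> F] --> (0 : X).
Proof.
move=> PF EL; apply: cvg_ultra => U UU FU.
have [x [q [_ wx pq]]] := orbit_ultralimit UU.
by have [<- _] := orbit_limit_rest EL UU FU wx pq.
Qed.

(** Every ultralimit at [-oo] is critical and lies in the closed ball of radius [r], whose only
    possible critical point is [d]. *)
Lemma orbit_alpha_limit (d : X) (r : R) :
  (forall y, `|y - d| <= r -> grad f y = 0 -> y = d) ->
  (forall s, s < 0 -> `|w s - d| <= r) -> w s @[s --> oo_n] --> d.
Proof.
move=> dr wr; have [L _ EL] := orbit_energy_ninfty.
apply: cvg_ultra => U UU FU.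
have [x [q [_ wx pq]]] := orbit_ultralimit UU.
have [_ gx] := orbit_limit_rest EL UU FU wx pq.
suff -> : d = x by [].
apply/esym; apply: dr => //.
have c : `|w s - d| @[s --> U] --> `|x - d|.
  by apply: cvg_norm; apply: cvgB => //; exact: cvg_cst.
apply: (cvgr_to_le c); apply: FU; exists 0; split; first exact: num_real.
exact: wr.
Qed.

(* If the orbit returned to [d'] and left it infinitely often, it would cross a
   small sphere around [d'] infinitely often and accumulate at a critical point there. *)
Lemma orbit_omega_limit : exists d' : X,
  [/\ `|d'| <= M, grad f d' = 0 & w s @[s --> oo_p] --> d'].
Proof.
have [L _ EL] := orbit_energy_pinfty.
have [U [UU sU]] := ultraFilterLemma (@proper_pinfty_nbhs R).
have [d [q [dM wd pq]]] := orbit_ultralimit UU.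
have [_ gd] := orbit_limit_rest EL UU sU wd pq.
exists d; split => //.
have [r r0 dr] := crit_isolated gd.
have wc := orbit_position_continuous A_spd gradf_cont rho_gt0 wp.
apply/cvgrPdist_le => e e0.
pose r' := Num.min r e.
have r'0 : 0 < r' by rewrite lt_min r0.
suff : \forall s \near oo_p, `|d - w s| < r'.
  by apply: filterS => s /ltW; rewrite le_min => /andP[].
apply: contrapT => nF.
have cross S : exists2 s, S < s & `|d - w s| = r'.
  have [s1 [Ss1 ws1]] : exists s, S < s /\ `|d - w s| < r'.
    have N1 : U [set s | `|d - w s| < r'] by have /cvgrPdist_lt := wd; exact.
    have N2 : U [set s | S < s].
      by apply: sU; exists S; split => //; exact: num_real.
    have N12 : U ([set s | S < s] `&` [set s | `|d - w s| < r']) by exact: filterI.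
    by have [s [? ?]] := filter_ex N12; exists s.
  have [s2 [s12 ws2]] : exists s, s1 < s /\ r' <= `|d - w s|.
    apply: contrapT => H; apply: nF; exists s1; split; first exact: num_real.
    move=> s ss; rewrite ltNge; apply/negP => ?; apply: H; by exists s.
  have cd : {within `[s1, s2], continuous (fun s => `|d - w s|)}.
    apply: continuous_subspaceT => s; apply: cvg_norm; apply: cvgB.
      exact: cvg_cst.
    exact: wc.
  have [|c cs <-] := IVT (ltW s12) cd (_ : _ <= r' <= _).
    by rewrite ge_min le_max ws2 orbT (ltW ws1).
  exists c => //; move: cs; rewrite in_itv/= => /andP[s1c _].
  exact: lt_le_trans s1c.
(* Crossing times are unbounded, so the trace of [oo_p] on them is proper. An ultrafilter finer than
   it yields a critical point at distance [r' <= r] from [d], which isolation excludes. *)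
have PW : ProperFilter (within [set s | `|d - w s| = r'] oo_p).
  apply: Build_ProperFilter => -[S [_ HS]].
  by have [s Ss ws] := cross S; exact: (HS s Ss).
have [G [UG sG]] := ultraFilterLemma PW.
have pG : oo_p `<=` G by move=> N HN; apply: sG; exact: filterS HN.
have [x [q' [_ wx pq']]] := orbit_ultralimit UG.
have [_ gx] := orbit_limit_rest EL UG pG wx pq'.
have c : `|d - w s| @[s --> G] --> `|d - x|.
  by apply: cvg_norm; apply: cvgB => //; exact: cvg_cst.
have GW : G [set s | `|d - w s| = r'] by apply: sG; exact: withinT.
have xr : `|d - x| = r'.
  apply/eqP; rewrite eq_le; apply/andP; split.
    by apply: (cvgr_to_le c); apply: filterS GW => s /= ->.
  by apply: (cvgr_to_ge c); apply: filterS GW => s /= ->.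
have xd : x = d by apply: dr => //; rewrite distrC xr ge_min lexx.
by move: r'0; rewrite -xr xd subrr normr0 ltxx.
Qed.

End Orbit.

(** The rest times [a] and [b] may depend on [dl], while [rho] and [M] may not; this uniformity
    allows ultralimits as [dl] tends to 0. *)
Definition connects (d v : X) : Prop := forall dl, 0 < dl ->
  exists w p : R -> X, [/\ pseudo_orbit dl w p,
    exists a, forall s, s <= a -> w s = d /\ p s = 0
  & exists b, forall s, b <= s -> w s = v /\ p s = 0].

(* Pseudo-orbits may jump, so one can start at rest at [d] and jump at time [S]. *)
Lemma pseudo_orbit_splice dl eta (w p : R -> X) (d : X) (S : R) :
  pseudo_orbit dl w p -> 0 <= dl -> `|d| <= M -> grad f d = 0 ->
  `|w S - d| <= eta -> `|p S| <= eta -> `|A *m p S| <= eta ->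
  `|force (w S) (p S)| <= eta -> energy (w S) (p S) <= energy d 0 + eta ->
  pseudo_orbit (dl + 2 * eta) (fun s => if s < S then d else w s)
    (fun s => if s < S then 0 else p s).
Proof.
move=> [wM pM E H] dl0 dM gd hw hp hA hF hE.
have eta0 : 0 <= eta := le_trans (normr_ge0 _) hw.
have F0 : force d 0 = 0 by rewrite /force mulmx0 add0r.
split.
- by move=> s; case: ifP.
- by move=> s; case: ifP => // _; rewrite normr0 (le_trans _ (pM 0)).
- move=> s t st; case: ltP => tS; case: ltP => sS; last by have := E s t st; lra.
  + by rewrite lerDl; lra.
  + by have := le_lt_trans (le_trans sS st) tS; rewrite ltxx.
  + by have := E S t tS; lra.
- move=> e s t e0 /andP[st ts]; have r1 := rho_le1 e.
  have st0 : 0 <= t - s by rewrite subr_ge0.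
  have est0 : 0 <= e * (t - s) by rewrite mulr_ge0// ltW.
  case: ltP => tS; case: ltP => sS.
  + rewrite !subrr scaler0 mulmx0 F0 scaler0 addr0 subr0 normr0; lra.
  + by have := le_lt_trans (le_trans sS st) tS; rewrite ltxx.
  (* Interval across the jump: the estimate from [S] on is corrected by the jump and by a term
     linear in [t - S]. Each is at most [eta], as [t - S <= rho e <= 1]; hence [2 * eta]. *)
  + have St : S <= t <= S + rho e by rewrite tS/=; lra.
    have [h1 h2] := H e S t e0 St.
    have tS0 : 0 <= t - S by rewrite subr_ge0.
    have tS1 : t - S <= 1 by lra.
    have le1 (z : X) : `|z| <= eta -> `|(t - S) *: z| <= eta.
      by move=> hz; rewrite normrZ ger0_norm//; apply: le_trans (ler_piMl _ tS1) hz.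
    have ee : e * (t - S) <= e * (t - s) by apply: ler_wpM2l; lra.
    rewrite F0 !scaler0 addr0 !subr0; split.
    * have -> : w t - d = (w t - w S - (t - S) *: p S) + (t - S) *: p S + (w S - d).
        by rewrite subrK addrA subrK.
      apply: le_trans (ler_normD _ _) _.
      have := ler_normD (w t - w S - (t - S) *: p S) ((t - S) *: p S).
      by have := le1 _ hp; lra.
    * have -> : A *m p t = (A *m (p t - p S) + (t - S) *: force (w S) (p S))
           - (t - S) *: force (w S) (p S) + A *m p S.
        by rewrite addrK mulmxBr subrK.
      apply: le_trans (ler_normD _ _) _.
      have := ler_normB (A *m (p t - p S) + (t - S) *: force (w S) (p S))
        ((t - S) *: force (w S) (p S)).
      by have := le1 _ hF; lra.
  + by have [|h1 h2] := H e s t e0 _; [rewrite st|split; lra].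
Qed.

Definition heteroclinic (y : R -> X) (a b : X) : Prop :=
  [/\ forall s : R,
        [/\ derivable y s 1, derivable (derive1 y) s 1
          & A *m derive1 (derive1 y) s + B *m derive1 y s + grad f (y s) = 0],
      y s @[s --> -oo] --> a,
      y s @[s --> +oo] --> b,
      derive1 y s @[s --> -oo] --> (0 : X)
    & derive1 y s @[s --> +oo] --> (0 : X)].

Lemma orbit_heteroclinic (w p : R -> X) (a b : X) : pseudo_orbit 0 w p ->
  w s @[s --> -oo] --> a -> w s @[s --> +oo] --> b -> heteroclinic w a b.
Proof.
move=> wp wa wb.
have v := orbit_velocity A_spd gradf_cont rho_gt0 wp.
have dw : derive1 w = p.
  by apply/funext => s; rewrite derive1E; have [] := v s.
have [L1 _ EL1] := orbit_energy_ninfty wp.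
have [L2 _ EL2] := orbit_energy_pinfty wp.
split; [rewrite dw|exact: wa|exact: wb|rewrite dw|rewrite dw].
- move=> s; have [d1 _] := v s.
  have [d2 d2E] := orbit_acceleration A_spd gradf_cont rho_gt0 wp s.
  split; [exact: d1|exact: d2|].
  rewrite derive1E d2E mulmxN mulKVmx; last exact: posdef_unitmx.
  by rewrite -addrA; exact: addNr.
- exact: (orbit_momentum_vanish wp _ EL1).
- exact: (orbit_momentum_vanish wp _ EL2).
Qed.

Lemma connects_step (d v : X) : grad f d = 0 -> d <> v -> connects d v ->
  exists (d' : X) (y : R -> X), [/\ `|d'| <= M, grad f d' = 0, f d' < f d,
    heteroclinic y d d' & connects d' v].
Proof.
move=> gd dv cdv.
have [r1 r00 dr0] := crit_isolated gd.
(* [r] isolates [d] and is at most the distance to [v], so the final rest at [v] counts as outside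
   the open ball. *)
pose r := Num.min r1 `|v - d|.
have vd0 : 0 < `|v - d| by rewrite normr_gt0 subr_eq0; apply/eqP => /esym.
have r_gt0 : 0 < r by rewrite lt_min r00.
have dr y : `|y - d| <= r -> grad f y = 0 -> y = d.
  by rewrite le_min => /andP[+ _]; exact: dr0.
have k0 (k : nat) : 0 < k.+1%:R^-1 :> R by rewrite invr_gt0.
have /choice[W HW] : forall k : nat, exists wp : (R -> X) * (R -> X),
    [/\ pseudo_orbit k.+1%:R^-1 wp.1 wp.2, r <= `|wp.1 0 - d|,
        forall s, s <= - k.+1%:R^-1 -> `|wp.1 s - d| <= r
      & exists b, forall s, b <= s -> wp.1 s = v /\ wp.2 s = 0].
  move=> k; have [w [p [oo [a wa] [b wb]]]] := cdv _ (k0 k).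
  (* Because of jumps the infimum of these times need not be attained. A time [s0] of [S], less than
     [k.+1%:R^-1] above it, becomes time 0, and all times up to [- k.+1%:R^-1] then lie in the
     ball. *)
  pose S := [set s | r <= `|w s - d|].
  have Sb : S b by rewrite /S/= (wb b (lexx b)).1 ge_min lexx orbT.
  have lbS : lbound S a.
    move=> s Ss; rewrite leNgt; apply/negP => /ltW /wa [wsd _].
    by move: Ss; rewrite /S/= wsd subrr normr0 leNgt r_gt0.
  have hiS : has_inf S by split; [exists b|exists a].
  have [s0 Ss0 s0i] := inf_adherent (k0 k) hiS.
  exists (fun s => w (s0 + s), fun s => p (s0 + s)); split => /=.
  - exact: pseudo_orbit_shift.
  - by rewrite addr0.
  - move=> s sk; rewrite leNgt; apply/negP => /ltW ws.
    have := ge_inf hiS.2 (ws : S (s0 + s)).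
    by move: s0i sk; move: (_^-1) (inf S) => c i; lra.
  - by exists (b - s0) => s sb; apply: wb; lra.
have [U [UU sU]] := ultraFilterLemma (@eventually_filter).
have dl0 : (fun k : nat => k.+1%:R^-1 : R) k @[k --> U] --> (0 : R).
  by move=> N /(@cvg_harmonic R) HN; exact: sU.
have oW k : pseudo_orbit k.+1%:R^-1 (W k).1 (W k).2 by have [] := HW k.
have [y [p [Wy Wp oy]]] := pseudo_orbit_limit f_diff gradf_cont UU dl0 oW.
have cn s : `|(W k).1 s - d| @[k --> U] --> `|y s - d|.
  by apply: cvg_norm; apply: cvgB; [exact: Wy|exact: cvg_cst].
have y0 : r <= `|y 0 - d|.
  by apply: (cvgr_to_ge (cn 0)); apply: filterE => k; have [] := HW k.
have ys s : s < 0 -> `|y s - d| <= r.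
  move=> s0; apply: (cvgr_to_le (cn s)).
  have s0' : 0 < - s by lra.
  have : U [set k : nat | k.+1%:R^-1 <= - s].
    by apply: (cvgr_le (0 : R)).
  by apply: filterS => k /= ks; have [_ _ + _] := HW k; apply; rewrite lerNr.
have yc := orbit_position_continuous A_spd gradf_cont rho_gt0 oy.
(* Continuity of the limit orbit places [y 0] exactly on the sphere of radius [r], where no point is
   critical. *)
have y0r : `|y 0 - d| <= r.
  have c0 : `|y s - d| @[s --> 0^'-] --> `|y 0 - d|.
    apply: cvg_norm; apply: cvgB; last exact: cvg_cst.
    exact/cvg_at_left_filter/yc.
  by apply: (cvgr_to_le c0); near=> s; exact: ys.
have gy0 : grad f (y 0) <> 0.
  by move=> g0; move: y0; rewrite (dr _ y0r g0) subrr normr0 leNgt r_gt0.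
have yd := orbit_alpha_limit oy dr ys.
have [d' [d'M gd' yd']] := orbit_omega_limit oy.
have [L1 EL1 cL1] := orbit_energy_ninfty oy.
have [L2 EL2 cL2] := orbit_energy_pinfty oy.
have p1 := orbit_momentum_vanish oy (@proper_ninfty_nbhs R) cL1.
have p2 := orbit_momentum_vanish oy (@proper_pinfty_nbhs R) cL2.
have E0 x : energy x 0 = f x by rewrite /energy dot0l mulr0 addr0.
have shift0 : (fun t => energy (y (t + 0)) (p (t + 0))) = (fun t => energy (y t) (p t)).
  by apply/funext => t; rewrite addr0.
have L1E : L1 = f d.
  have c1 : energy (y s) (p s) @[s --> oo_n] --> energy d 0 by exact: cvg_energy.
  have c2 := cL1 0; rewrite shift0 in c2.
  by rewrite -E0; exact: (cvg_unique (@norm_hausdorff _ _) c2 c1).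
have L2E : L2 = f d'.
  have c1 : energy (y s) (p s) @[s --> oo_p] --> energy d' 0 by exact: cvg_energy.
  have c2 := cL2 0; rewrite shift0 in c2.
  by rewrite -E0; exact: (cvg_unique (@norm_hausdorff _ _) c2 c1).
exists d', y; split => //.
- rewrite -L1E -L2E lt_neqAle (le_trans (EL2 0) (EL1 0)) andbT.
  (* Equal limits at both ends would make the energy constant, hence [y 0] critical. *)
  apply/negP => /eqP L12; apply: gy0.
  have Ec s : energy (y s) (p s) = L1.
    by apply/eqP; rewrite eq_le EL1/= -L12 EL2.
  by have [] := orbit_const_energy A_spd B_spd f_diff gradf_cont rho_gt0 oy Ec 0.
- exact: orbit_heteroclinic oy yd yd'.
- move=> dl dl_gt0.
  (* A continuous gauge of the deviation from rest at [d']: it vanishes at [(d', 0)] and dominates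
     every quantity that [pseudo_orbit_splice] requires to be small. *)
  pose g (x q : X) := `|x - d'| + `|q| + `|A *m q| + `|force x q| +
    `|energy x q - energy d' 0|.
  have cg (I : Type) (G : set_system I) (FG : Filter G) (h k : I -> X) x q :
      h i @[i --> G] --> x -> k i @[i --> G] --> q -> g (h i) (k i) @[i --> G] --> g x q.
    move=> hx kq.
    apply: cvgD; last by apply: cvg_norm; apply: cvgB; [exact: cvg_energy|exact: cvg_cst].
    apply: cvgD; last by apply: cvg_norm; exact: cvg_force.
    apply: cvgD; last by apply: cvg_norm; exact: cvg_mulmxl.
    apply: cvgD; last exact: cvg_norm.
    by apply: cvg_norm; apply: cvgB; [exact: hx|exact: cvg_cst].
  have g0 : g d' 0 = 0.
    by rewrite /g !subrr mulmx0 /force mulmx0 gd' addr0 !normr0 !addr0.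
  (* Splicing costs twice this quarter, and the index [k] chosen below adds less than a third
     one. *)
  have dl4 : 0 < dl / 4 by lra.
  have [S HS] : exists S, g (y S) (p S) < dl / 4.
    have N : \forall s \near oo_p, g (y s) (p s) < dl / 4.
      by apply: (cvgr_lt (g d' 0)); [exact: cg|rewrite g0].
    exact: filter_ex N.
  have N1 : U [set k | g ((W k).1 S) ((W k).2 S) < dl / 4].
    by apply: (cvgr_lt (g (y S) (p S))); [exact: cg|exact: HS].
  have N2 : U [set k : nat | k.+1%:R^-1 < dl / 4].
    by apply: (cvgr_lt (0 : R)).
  have N12 : U ([set k | g ((W k).1 S) ((W k).2 S) < dl / 4] `&`
    [set k : nat | k.+1%:R^-1 < dl / 4]) by exact: filterI.
  have [k [/= gk dlk]] := filter_ex N12.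
  have [_ _ _ [b Wb]] := HW k.
  exists (fun s => if s < S then d' else (W k).1 s),
    (fun s => if s < S then 0 else (W k).2 s).
  have [h1 h2 h3 [h4 h5]] : [/\ `|(W k).1 S - d'| <= dl / 4, `|(W k).2 S| <= dl / 4,
      `|A *m (W k).2 S| <= dl / 4 & `|force ((W k).1 S) ((W k).2 S)| <= dl / 4 /\
      `|energy ((W k).1 S) ((W k).2 S) - energy d' 0| <= dl / 4].
    move: gk; rewrite /g.
    have := normr_ge0 ((W k).1 S - d'); have := normr_ge0 ((W k).2 S).
    have := normr_ge0 (A *m (W k).2 S); have := normr_ge0 (force ((W k).1 S) ((W k).2 S)).
    have := normr_ge0 (energy ((W k).1 S) ((W k).2 S) - energy d' 0).
    by move=> a1 a2 a3 a4 a5 a6; split; [lra|lra|lra|split; lra].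
  split.
  + have := pseudo_orbit_splice (oW k) (ltW (k0 k)) d'M gd' h1 h2 h3 h4.
    have h6 : energy ((W k).1 S) ((W k).2 S) <= energy d' 0 + dl / 4.
      by have := le_trans (ler_norm _) h5; lra.
    move=> /(_ h6) [q1 q2 q3 q4]; split => //.
      by move=> s t /q3; move: dlk; move: (_^-1) => c; lra.
    by move=> e s t e0 /(q4 e s t e0)[]; move: dlk; move: (_^-1) => c; split; lra.
  + by exists (S - 1) => s sS; rewrite !ifT//; lra.
  + exists (Num.max b S) => s; rewrite ge_max => /andP[bs Ss].
    by rewrite ltNge Ss/=; exact: Wb.
Unshelve. all: by end_near. Qed.

(** Strict descent of [f] is recorded instead of distinctness: it is checked link by link and gives
    distinctness by transitivity. *)
Definition heteroclinic_chain (u v : X) : Prop :=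
  exists (m : nat) (us : nat -> X) (vs : nat -> R -> X),
    [/\ us 0%N = u, us m = v, forall i, (i <= m)%N -> grad f (us i) = 0,
      forall i, (i < m)%N -> f (us i.+1) < f (us i)
    & forall i, (1 <= i <= m)%N -> heteroclinic (vs i) (us i.-1) (us i)].

Lemma heteroclinic_chain_cons (u d v : X) (y : R -> X) :
  grad f u = 0 -> f d < f u -> heteroclinic y u d ->
  heteroclinic_chain d v -> heteroclinic_chain u v.
Proof.
move=> gu fdu hy [m [us [vs [us0 usm gus fus hvs]]]].
(* Links are numbered from 1: index 1 receives the new orbit, the old ones move up by one, and index
   0 takes [y] as a default. *)
exists m.+1, (fun i => if i is j.+1 then us j else u),
  (fun i => if i is j.+2 then vs j.+1 else y).
split => //.
- by case.
- by case=> [|i] im /=; [rewrite us0|exact: fus].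
- by case=> [|[|i]]//= im; [rewrite us0|exact: (hvs i.+1)].
Qed.

(* An infinite descent would produce infinitely many critical points in a
   compact set, which contradicts their isolation. *)
Lemma connects_chain (u v : X) : grad f u = 0 -> connects u v -> heteroclinic_chain u v.
Proof.
move=> gu cuv; apply: contrapT => nch.
pose P (d : X) := [/\ connects d v, grad f d = 0, `|d| <= M & ~ heteroclinic_chain d v].
have Pu : P u.
  split => //; have [w [p [[wM _ _ _] [a wa] _]]] := cuv 1 ltr01.
  by have [<- _] := wa a (lexx a).
(* [P d] is placed inside the existential as a premise, so that choice yields a total map to
   iterate. *)
have Pstep d : exists d', P d -> P d' /\ f d' < f d.
  have [[c gd dM nc]|] := pselect (P d); last by exists d.
  have dv : d <> v.
    move=> dv; apply: nc; exists 0%N, (fun=> d), (fun=> cst d).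
    by split => //; case.
  have [d' [y [d'M gd' fd' hy c']]] := connects_step gd dv c.
  exists d' => _; split => //; split => // ch; apply: nc.
  exact: heteroclinic_chain_cons hy ch.
have [g Hg] := choice Pstep.
pose x k := iter k g u.
have Px k : P (x k) by elim: k => // k IH; have [] := Hg _ IH.
have xlt i j : (i < j)%N -> f (x j) < f (x i).
  elim: j => // j IH; rewrite ltnS leq_eqVlt => /orP[/eqP ->|/IH h].
    by have [] := Hg _ (Px j).
  by apply: lt_trans h; have [] := Hg _ (Px j).
have [U [UU sU]] := ultraFilterLemma (@eventually_filter).
have xM k : [set z : X | `|z| <= M] (x k) by have [] := Px k.
have [c cM xc] := ultra_cvg_in_compact UU (@col_ball_compact R n.+1 M) xM.
have gc : grad f c = 0.
  apply: (cvg_unique (@norm_hausdorff _ _) (cvg_gradf gradf_cont _ xc)).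
  rewrite (_ : (fun k => grad f (x k)) = fun=> 0); first exact: cvg_cst.
  by apply/funext => k; have [] := Px k.
have [r r0 cr] := crit_isolated gc.
(* Isolation makes the sequence equal to its limit along the ultrafilter, hence at two different
   indices, against strict descent. *)
have N1 : U [set k | x k = c].
  have : U [set k | `|c - x k| <= r] by have /cvgrPdist_le := xc; apply.
  by apply: filterS => k /= kr; apply: cr; [rewrite distrC|have [] := Px k].
have [k0 xk0] := filter_ex N1.
have N2 : U [set k | (k0 < k)%N] by apply: sU; exact: nbhs_infty_gt.
have N12 : U ([set k | x k = c] `&` [set k | (k0 < k)%N]) by exact: filterI.
have [k [/= xk kk]] := filter_ex N12.
by have := xlt _ _ kk; rewrite xk xk0 ltxx.
Qed.

End HeteroclinicChains.

(** * Locally integrable functions and integrals over segments *)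

Section LocallySquareIntegrable.
Context {R : realType}.
Local Notation mu := (@lebesgue_measure R).
Implicit Types (f g h : R -> R) (s t r : R).

(** Functions live on the whole line because trajectories will be extended by rest; no domain has to
    be carried along. *)
Definition loc_int f : Prop := measurable_fun [set: R] f /\
  forall s t, mu.-integrable `[s, t] (EFin \o f).

Definition loc_int2 f : Prop := measurable_fun [set: R] f /\
  forall s t, mu.-integrable `[s, t] (EFin \o (fun x => f x ^+ 2)).

Lemma loc_int_le f g : measurable_fun [set: R] f ->
  (forall x, `|f x| <= g x) -> loc_int g -> loc_int f.
Proof.
move=> mf fg [mg ig]; split => // s t.
apply: (le_integrable _ _ _ (ig s t)) => //.
  by apply/measurable_EFinP; exact: measurable_funS mf.
move=> x _; rewrite /= lee_fin; exact: le_trans (fg x) (ler_norm _).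
Qed.

Lemma loc_int_cont f : continuous f -> loc_int f.
Proof.
move=> cf; split; first exact: continuous_measurable_fun.
move=> s t; apply: continuous_compact_integrable; first exact: segment_compact.
exact: continuous_subspaceT.
Qed.

Lemma loc_intD f g : loc_int f -> loc_int g -> loc_int (fun x => f x + g x).
Proof.
move=> [mf If] [mg Ig]; split; first exact: measurable_funD.
by move=> s t; have := integrableD _ (If s t) (Ig s t); apply.
Qed.

Lemma loc_intZ (k : R) f : loc_int f -> loc_int (fun x => k * f x).
Proof.
move=> [mf If]; split; first exact: measurable_funM.
by move=> s t; have := integrableZl _ k (If s t); apply.
Qed.

Lemma loc_intN f : loc_int f -> loc_int (fun x => - f x).
Proof.
by move=> /(loc_intZ (-1)); congr loc_int; apply/funext => x; rewrite mulN1r.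
Qed.

Lemma loc_intB f g : loc_int f -> loc_int g -> loc_int (fun x => f x - g x).
Proof. by move=> If /loc_intN; exact: loc_intD. Qed.

Lemma loc_int_norm f : loc_int f -> loc_int (fun x => `|f x|).
Proof.
move=> [mf If]; split; first exact: measurableT_comp.
by move=> s t; exact: integrable_norm (If s t).
Qed.

Lemma loc_int_sum (I : Type) (r : seq I) (h : I -> R -> R) :
  (forall i, loc_int (h i)) -> loc_int (fun x => \sum_(i <- r) h i x).
Proof.
move=> H; elim: r => [|i r IH].
  by under eq_fun do rewrite big_nil; apply: loc_int_cont => x; exact: cvg_cst.
by under eq_fun do rewrite big_cons; exact: loc_intD.
Qed.

Lemma loc_int2_cont f : continuous f -> loc_int2 f.
Proof.
move=> cf; split; first exact: continuous_measurable_fun.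
have : loc_int (fun x => f x ^+ 2) by apply: loc_int_cont => x; apply: cvgM; exact: cf.
by case.
Qed.

Lemma loc_int2_sqr f : loc_int2 f -> loc_int (fun x => f x ^+ 2).
Proof. by move=> [mf If]; split => //; exact: measurable_funX. Qed.

(** The product is dominated by [f ^+ 2 + g ^+ 2]. *)
Lemma loc_intM f g : loc_int2 f -> loc_int2 g -> loc_int (fun x => f x * g x).
Proof.
move=> lf lg; apply: (@loc_int_le _ (fun x => f x ^+ 2 + g x ^+ 2)).
- by case: lf => mf _; case: lg => mg _; exact: measurable_funM.
- move=> x; rewrite normrM -(real_normK (num_real (f x))) -(real_normK (num_real (g x))).
  have := sqr_ge0 (`|f x| - `|g x|).
  by have := sqr_ge0 (`|f x|); have := sqr_ge0 (`|g x|); nra.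
- by apply: loc_intD; exact: loc_int2_sqr.
Qed.

Lemma loc_int2_int f : loc_int2 f -> loc_int f.
Proof.
move=> lf; have l1 : loc_int2 (fun=> 1) by apply: loc_int2_cont => x; exact: cvg_cst.
have := loc_intM lf l1.
by congr loc_int; apply/funext => x; rewrite mulr1.
Qed.

Lemma loc_int2D f g : loc_int2 f -> loc_int2 g -> loc_int2 (fun x => f x + g x).
Proof.
move=> lf lg; have [mf _] := lf; have [mg _] := lg.
split; first exact: measurable_funD.
have : loc_int (fun x => (f x + g x) ^+ 2).
  apply: (@loc_int_le _ (fun x => 2 * (f x ^+ 2 + g x ^+ 2))).
  - by apply: measurable_funX; exact: measurable_funD.
  - by move=> x; rewrite ger0_norm ?sqr_ge0//; have := sqr_ge0 (f x - g x); nra.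
  - by apply: loc_intZ; apply: loc_intD; exact: loc_int2_sqr.
by case.
Qed.

Lemma loc_int2Z (k : R) f : loc_int2 f -> loc_int2 (fun x => k * f x).
Proof.
move=> lf; have [mf _] := lf; split; first exact: measurable_funM.
have := loc_intZ (k ^+ 2) (loc_int2_sqr lf).
rewrite (_ : (fun x => k ^+ 2 * f x ^+ 2) = (fun x => (k * f x) ^+ 2)); first by case.
by apply/funext => x; rewrite exprMn.
Qed.

Lemma loc_int2_sum (I : Type) (r : seq I) (h : I -> R -> R) :
  (forall i, loc_int2 (h i)) -> loc_int2 (fun x => \sum_(i <- r) h i x).
Proof.
move=> H; elim: r => [|i r IH].
  by under eq_fun do rewrite big_nil; apply: loc_int2_cont => x; exact: cvg_cst.
by under eq_fun do rewrite big_cons; exact: loc_int2D.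
Qed.

(** For [t < s] the segment is empty and the value is 0, without the usual sign convention; hence
    the order hypotheses in [Iint_chasles]. *)
Definition Iint f s t : R := \int[mu]_(x in `[s, t]) f x.

Lemma IintD f g s t : loc_int f -> loc_int g ->
  Iint (fun x => f x + g x) s t = Iint f s t + Iint g s t.
Proof. by move=> [_ If] [_ Ig]; exact: RintegralD. Qed.

Lemma IintZ k f s t : loc_int f -> Iint (fun x => k * f x) s t = k * Iint f s t.
Proof. by move=> [_ If]; exact: RintegralZl. Qed.

Lemma IintN f s t : loc_int f -> Iint (fun x => - f x) s t = - Iint f s t.
Proof.
move=> lf; rewrite -mulN1r -IintZ//; congr Iint.
by apply/funext => x; rewrite mulN1r.
Qed.

Lemma IintB f g s t : loc_int f -> loc_int g ->
  Iint (fun x => f x - g x) s t = Iint f s t - Iint g s t.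
Proof. by move=> lf lg; rewrite IintD ?IintN//; exact: loc_intN. Qed.

Lemma Iint_sum (I : Type) (r : seq I) (h : I -> R -> R) s t :
  (forall i, loc_int (h i)) ->
  Iint (fun x => \sum_(i <- r) h i x) s t = \sum_(i <- r) Iint (h i) s t.
Proof.
move=> H; elim: r => [|i r IH].
  rewrite big_nil; under eq_fun do rewrite big_nil.
  by rewrite /Iint Rintegral_cst// mul0r.
rewrite big_cons; under eq_fun do rewrite big_cons.
by rewrite IintD// ?IH//; exact: loc_int_sum.
Qed.

Lemma Iint_le f g s t : loc_int f -> loc_int g ->
  (forall x, s <= x <= t -> f x <= g x) -> Iint f s t <= Iint g s t.
Proof.
move=> [_ If] [_ Ig] fg; exact: le_Rintegral.
Qed.

Lemma Iint_norm f s t : loc_int f -> `|Iint f s t| <= Iint (fun x => `|f x|) s t.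
Proof. by move=> [_ If]; exact: le_normr_Rintegral. Qed.

Lemma Iint_cst (c : R) s t : s <= t -> Iint (fun=> c) s t = c * (t - s).
Proof.
move=> st; rewrite /Iint Rintegral_cst//; congr (_ * _).
have E : mu `[s, t]%classic = if s < t then (t - s)%:E else 0%E.
  by rewrite lebesgue_measure_itv/= lte_fin.
rewrite [X in fine X]E.
move: st; rewrite le_eqVlt => /predU1P[->|->//]; by rewrite ltxx subrr.
Qed.

Lemma Iint_chasles f r s t : loc_int f -> r <= s -> s <= t ->
  Iint f r t = Iint f r s + Iint f s t.
Proof.
move=> [_ If] rs st.
have := @Rintegral_itvB _ f (BLeft r) (BRight t) s (If r t).
rewrite !bnd_simp => /(_ rs st)/eqP; rewrite subr_eq => /eqP; rewrite /Iint => ->.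
rewrite addrC; congr (_ + _); apply: Rintegral_itv_obnd_cbnd.
apply: integrableS (If s t) => //.
by move=> x /=; rewrite !in_itv/= => /andP[/ltW -> ->].
Qed.

Lemma Iint_ge0 f s t : (forall x, 0 <= f x) -> 0 <= Iint f s t.
Proof. by move=> f0; exact: Rintegral_ge0. Qed.

Lemma Iint_FTC (f F : R -> R) s t : s <= t -> continuous f ->
  (forall x : R, is_derive x 1 F (f x)) -> Iint f s t = F t - F s.
Proof.
move=> + cf dF; rewrite le_eqVlt => /predU1P[->|st].
  by rewrite /Iint set_itv1 Rintegral_set1 subrr.
rewrite /Iint /Rintegral (@continuous_FTC2 _ f F)//.
- exact: continuous_subspaceT.
- have cF : continuous F.
    by move=> x; apply: differentiable_continuous; apply/derivable1_diffP.
  split => //.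
  + exact/cvg_at_right_filter/cF.
  + exact/cvg_at_left_filter/cF.
- by move=> x _; rewrite derive1E; exact: derive_val.
Qed.

End LocallySquareIntegrable.

(** * Constant extension of functions given on a segment *)

Section Clamp.
Context {R : realType}.
Implicit Types a b s t : R.

Definition clamp a b s : R := Num.max a (Num.min b s).

Lemma clamp_itv a b s : a <= b -> a <= clamp a b s <= b.
Proof.
by move=> ab; rewrite /clamp le_max lexx/= ge_max ab ge_min lexx.
Qed.

Lemma clamp_id a b s : a <= s <= b -> clamp a b s = s.
Proof. by rewrite /clamp => /andP[as_ sb]; rewrite (min_idPr sb) (max_idPr as_). Qed.

Lemma clamp_le a b s : a <= b -> s <= a -> clamp a b s = a.
Proof. by move=> ab sa; rewrite /clamp; apply: max_l; rewrite ge_min sa orbT. Qed.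

Lemma clamp_ge a b s : a <= b -> b <= s -> clamp a b s = b.
Proof. by move=> ab bs; rewrite /clamp min_l// max_r. Qed.

Lemma clamp_homo a b s t : s <= t -> clamp a b s <= clamp a b t.
Proof.
move=> st; rewrite /clamp ge_max !le_max lexx/=; apply/orP; right.
by rewrite le_min !ge_min lexx st orbT.
Qed.

Lemma clamp_continuous a b : continuous (clamp a b).
Proof.
move=> s; apply: continuous_max; first exact: cvg_cst.
by apply: continuous_min; [exact: cvg_cst|exact: cvg_id].
Qed.

Lemma comp_clamp_continuous (V : topologicalType) a b (f : R -> V) : a <= b ->
  {within `[a, b], continuous f} -> continuous (f \o clamp a b).
Proof.
move=> ab /subspace_continuousP cf s N Nf.
have cs : `[a, b]%classic (clamp a b s) by rewrite /= in_itv/= clamp_itv.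
have := cf _ cs N Nf; rewrite /fmap /within /= => H.
have H' : \forall t \near s, clamp a b t \in `[a, b] -> N (f (clamp a b t)).
  exact: clamp_continuous H.
by apply: filterS H' => t; apply; rewrite in_itv/= clamp_itv.
Qed.

End Clamp.

(** * A piecewise quadratic step of class C^1 *)

Section Smoothstep.
Context {R : realType}.

Definition pos2 (r : R) : R := Num.max 0 r ^+ 2.

(** In all four sign cases of [r] and [t] the first-order remainder is at most [(t - r) ^+ 2]. *)
Lemma is_derive_pos2 (r : R) : is_derive r 1 pos2 (2 * Num.max 0 r).
Proof.
apply: is_derive_increments => e e0.
have N := @near_dist_le R R^o r e e0.
apply: filterS N => t rt.
have rt0 := normr_ge0 (t - r).
apply: (@le_trans _ _ (`|t - r| ^+ 2)); last first.
  by rewrite expr2 ler_wpM2r// distrC.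
have sq := sqr_ge0 (t - r).
rewrite real_normK ?num_real// /pos2 [_ *: _]mulrC ler_norml.
have [r0|r0] := leP 0 r; have [t0|t0] := leP 0 t;
  rewrite ?mulr0 ?expr0n/= ?mul0r; apply/andP; split; nra.
Qed.

(** Equals 2 r^2 on [0, 1/2] and 1 - 2 (1 - r)^2 on [1/2, 1], and is constant on either side of
    [0, 1]. Its derivative is the hat function of height 2 and mass 1. *)
Definition smoothstep (r : R) : R :=
  2 * pos2 r - 4 * pos2 (r - 2^-1) + 2 * pos2 (r - 1).

Definition smoothstep' (r : R) : R :=
  4 * Num.max 0 r - 8 * Num.max 0 (r - 2^-1) + 4 * Num.max 0 (r - 1).

Lemma is_derive_smoothstep (k x s : R) :
  is_derive s 1 (fun t => smoothstep (k * (t - x))) (k * smoothstep' (k * (s - x))).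
Proof.
have d1 (c : R) : is_derive s 1 (fun t : R => k * (t - x) - c) k.
  have h : is_derive s 1 (fun t : R => k *: (t - x) - c) (k *: (1 - 0) - 0).
    by apply: is_deriveB.
  by apply: is_derive_eq h _; rewrite !subr0; exact: mulr1.
have d2 (c : R) : is_derive s 1 (fun t => pos2 (k * (t - x) - c))
    (2 * Num.max 0 (k * (s - x) - c) * k).
  exact: (@is_derive1_comp _ pos2 (fun t => k * (t - x) - c) s _ _
    (is_derive_pos2 _) (d1 c)).
have dz (a c : R) : is_derive s 1 (fun t => a * pos2 (k * (t - x) - c))
    (a * (2 * Num.max 0 (k * (s - x) - c) * k)) by have := is_deriveZ a (d2 c).
have := is_deriveD (is_deriveB (dz 2 0) (dz 4 2^-1)) (dz 2 1).
rewrite (_ : (_ + _)%R = (fun t => smoothstep (k * (t - x)))).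
  by move/is_derive_eq; apply; rewrite /smoothstep' subr0; ring.
by apply/funext => t; rewrite /smoothstep !fctE subr0.
Qed.

Lemma smoothstep'_continuous : continuous smoothstep'.
Proof.
have cm (c : R) : continuous (fun r : R => Num.max 0 (r - c)).
  move=> r; apply: (@continuous_max _ _ (fun=> 0) (fun r => r - c)).
    exact: cvg_cst.
  by apply: cvgB; [exact: cvg_id|exact: cvg_cst].
have -> : smoothstep' = (fun r => 4 * Num.max 0 (r - 0) -
    8 * Num.max 0 (r - 2^-1) + 4 * Num.max 0 (r - 1)).
  by apply/funext => r; rewrite subr0.
by move=> r; apply: cvgD; [apply: cvgB|]; apply: cvgMr; exact: cm.
Qed.

Lemma smoothstep_le0 r : r <= 0 -> smoothstep r = 0.
Proof.
move=> r0; rewrite /smoothstep /pos2 !(max_idPl _)//; first by rewrite expr0n/=; ring.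
  by lra.
by lra.
Qed.

Lemma smoothstep_ge1 r : 1 <= r -> smoothstep r = 1.
Proof.
move=> r1; rewrite /smoothstep /pos2 !(max_idPr _); first by field.
all: by lra.
Qed.

Lemma smoothstep'_le0 r : r <= 0 -> smoothstep' r = 0.
Proof.
move=> r0; rewrite /smoothstep' !(max_idPl _)//; first by ring.
  by lra.
by lra.
Qed.

Lemma smoothstep'_ge1 r : 1 <= r -> smoothstep' r = 0.
Proof.
move=> r1; rewrite /smoothstep' !(max_idPr _); first by field.
all: by lra.
Qed.

Lemma smoothstep'_ge0 r : 0 <= smoothstep' r.
Proof.
rewrite /smoothstep'; have [|] := leP 0 r; have [|] := leP 0 (r - 2^-1);
  have [|] := leP 0 (r - 1); lra.
Qed.

Lemma smoothstep_itv r : 0 <= smoothstep r <= 1.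
Proof.
rewrite /smoothstep /pos2; have [|] := leP 0 r; have [|] := leP 0 (r - 2^-1);
  have [|] := leP 0 (r - 1) => *; apply/andP; split; nra.
Qed.

End Smoothstep.

(** * A continuous function is a primitive of its weak derivative *)

Section WeakDerivative.
Context {R : realType}.
Local Notation mu := (@lebesgue_measure R).
Implicit Types (f g h : R -> R) (a b x y : R).

Lemma Iint_oo f a b : loc_int f -> \int[mu]_(s in `]a, b[) f s = Iint f a b.
Proof.
move=> [_ If]; rewrite Rintegral_itv_bndo_bndc.
  rewrite Rintegral_itv_obnd_cbnd//; apply: integrableS (If a b) => //.
  by move=> s /=; rewrite !in_itv/= => /andP[/ltW -> ->].
apply: integrableS (If a b) => //.
by move=> s /=; rewrite !in_itv/= => /andP[/ltW -> /ltW ->].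
Qed.

Lemma patch_loc_int2 a b g : L2 a b g -> loc_int2 (g \_ `]a, b[).
Proof.
move=> [mg Ig]; split.
  by apply/measurable_restrict => //; rewrite setTI.
move=> s t.
have -> : EFin \o (fun r => (g \_ `]a, b[) r ^+ 2) = (fun r => (g r ^+ 2)%:E) \_ `]a, b[.
  by apply/funext => r; rewrite /= !patchE; case: ifP => // _; rewrite expr0n.
apply/integrable_restrict => //; apply: integrableS Ig => //.
exact: measurableI.
Qed.

Lemma near_dist_lt x (e : R) : 0 < e -> \forall y \near x, `|x - y| < e.
Proof. by move=> e0; have /cvgrPdist_lt := @cvg_id _ (nbhs x); exact. Qed.

Lemma near_scale_ge1 (c : R) : 0 < c -> \forall k \near \oo, 1 <= k.+1%:R * c.
Proof.
move=> c0; have := near_infty_natSinv_lt (PosNum c0).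
by apply: filterS => k /= /ltW; rewrite invf_ple ?posrE// -[leLHS]div1r ler_pdivrMr.
Qed.

(** The kernel is nonnegative, vanishes outside [[x, x + k.+1%:R^-1]], and has mass 1 on [[a, b]]
    once that interval fits inside. *)
Lemma approx_delta h a b x : continuous h -> a < x -> x < b ->
  Iint (fun s => h s * (k.+1%:R * smoothstep' (k.+1%:R * (s - x)))) a b
    @[k --> \oo] --> h x.
Proof.
move=> ch ax xb; apply/cvgrPdist_le => e e0.
have [d /= d0 hd] : exists2 d, 0 < d & forall s, `|x - s| < d -> `|h x - h s| <= e.
  have /cvgrPdist_le/(_ e e0)/nbhs_ballP[d d0 H] := ch x.
  by exists d => // s xs; exact: H.
near=> k.
have cd : 1 <= k.+1%:R * d by near: k; exact: near_scale_ge1.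
have cb : 1 <= k.+1%:R * (b - x) by near: k; apply: near_scale_ge1; rewrite subr_gt0.
move: cd cb; set c : R := k.+1%:R => cd cb; have c0 : 0 < c by rewrite ltr0n.
pose th s := c * smoothstep' (c * (s - x)).
have th0 s : 0 <= th s by rewrite mulr_ge0 ?smoothstep'_ge0// ltW.
have cth : continuous th.
  move=> s; apply: cvgMr.
  apply: (@continuous_comp _ _ _ (fun s => c * (s - x)) smoothstep').
    by apply: cvgMr; apply: cvgB; [exact: cvg_id|exact: cvg_cst].
  exact: smoothstep'_continuous.
have ith : Iint th a b = 1.
  have -> := @Iint_FTC _ th _ a b (ltW (lt_trans ax xb)) cth (is_derive_smoothstep c x).
  rewrite smoothstep_ge1// smoothstep_le0 ?subr0//.
  by rewrite pmulr_rle0// subr_le0 ltW.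
have lth : loc_int2 th by exact: loc_int2_cont.
have lh : loc_int2 h by exact: loc_int2_cont.
have l1 := loc_intM lh lth.
rewrite -[h x]mulr1 -ith -IintZ; last exact: loc_int2_int.
rewrite -IintB//; last by apply: loc_intZ; exact: loc_int2_int.
apply: le_trans (Iint_norm _ _ _) _.
  by apply: loc_intB => //; apply: loc_intZ; exact: loc_int2_int.
apply: (@le_trans _ _ (Iint (fun s => e * th s) a b)); last first.
  by rewrite IintZ ?ith ?mulr1//; exact: loc_int2_int.
apply: Iint_le.
- by apply: loc_int_norm; apply: loc_intB => //; apply: loc_intZ; exact: loc_int2_int.
- by apply: loc_intZ; exact: loc_int2_int.
- move=> s _; rewrite -mulrBl normrM (ger0_norm (th0 s)).
  have [xs|xs] := ltP `|x - s| d; first by apply: ler_wpM2r => //; exact: hd.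
  suff -> : th s = 0 by rewrite !mulr0.
  have c1 : 1 <= `|c * (s - x)|.
    rewrite normrM gtr0_norm// distrC; apply: le_trans cd _.
    by rewrite ler_pM2l.
  rewrite /th; move: c1; rewrite ler_normr => /orP[|] c1.
    by rewrite smoothstep'_ge1 ?mulr0.
  by rewrite smoothstep'_le0 ?mulr0//; lra.
Unshelve. all: by end_near. Qed.

(* A C^1 approximation of the indicator of ]x, y] as [c] tends to infinity. *)
Definition plateau (x y c s : R) : R :=
  smoothstep (c * (s - x)) - smoothstep (c * (s - y)).

Lemma is_derive_plateau (x y c s : R) : is_derive s 1 (plateau x y c)
  (c * smoothstep' (c * (s - x)) - c * smoothstep' (c * (s - y))).
Proof.
have := is_deriveB (is_derive_smoothstep c x s) (is_derive_smoothstep c y s).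
exact.
Qed.

Lemma plateau_cvg x y s : x < y ->
  plateau x y k.+1%:R s @[k --> \oo] --> (\1_(`]x, y]) s : R).
Proof.
move=> xy; apply: cvg_near_cst.
have le0 z (k : nat) : s <= z -> smoothstep (k.+1%:R * (s - z)) = 0.
  by move=> sz; rewrite smoothstep_le0// pmulr_rle0// subr_le0.
have ge1 z : z < s -> \forall k \near \oo, smoothstep (k.+1%:R * (s - z)) = 1.
  rewrite -subr_gt0 => /near_scale_ge1; apply: filterS => k; exact: smoothstep_ge1.
rewrite /plateau indicE mem_setE in_itv/=.
have [sx|xs] := leP s x.
  by apply: filterE => k; rewrite !le0 ?subrr// (le_trans sx (ltW xy)).
have [sy|ys] := leP s y.
  by apply: filterS (ge1 _ xs) => k ->; rewrite le0// subr0.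
by apply: filterS2 (ge1 _ xs) (ge1 _ ys) => k -> ->; rewrite subrr.
Qed.

Lemma plateau_norm_le1 x y c s : `|plateau x y c s| <= 1.
Proof.
have /andP[h1 h2] := smoothstep_itv (c * (s - x)).
have /andP[h3 h4] := smoothstep_itv (c * (s - y)).
by rewrite ler_norml /plateau; apply/andP; split; lra.
Qed.

Lemma plateau_continuous x y c : continuous (plateau x y c).
Proof.
move=> s; apply: differentiable_continuous; apply/derivable1_diffP.
by have [] := is_derive_plateau x y c s.
Qed.

(** Both steps rise to the right of their base points, so the support may reach [y + c^-1];
    [1 < c * (b - y)] keeps it inside []a, b[]. *)
Lemma plateau_test_function a b x y c : a < x -> x < y -> y < b -> 0 < c ->
  1 < c * (b - y) -> test_function a b (plateau x y c).
Proof.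
move=> ax xy yb c0 cb.
have d1E : derive1 (plateau x y c) =
    (fun s => c * smoothstep' (c * (s - x)) - c * smoothstep' (c * (s - y))).
  by apply/funext => s; rewrite derive1E; have [] := is_derive_plateau x y c s.
have sub : closure [set s | plateau x y c s != 0] `<=` `[x, y + c^-1].
  have cl : closed `[x, y + c^-1]%classic.
    exact: compact_closed (@Rhausdorff R) (@segment_compact _ _ _).
  rewrite [X in _ `<=` X](closure_id _).1//.
  apply: closure_subset => s /=; rewrite in_itv/=; apply: contraNT.
  rewrite negb_and -!ltNge => /orP[sx|ys]; rewrite /plateau.
    rewrite !smoothstep_le0 ?subrr// pmulr_rle0// subr_le0.
      by rewrite ltW// (lt_trans sx).
    exact: ltW.
  have c1 : 1 <= c * (s - y).
    by rewrite mulrC -ler_pdivrMr// div1r; lra.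
  rewrite !smoothstep_ge1 ?subrr//.
  apply: le_trans c1 _; rewrite ler_pM2l//; lra.
split.
- by move=> s; have [] := is_derive_plateau x y c s.
- have cs z : continuous (fun s => c * smoothstep' (c * (s - z))).
    move=> s; apply: cvgMr.
    apply: (@continuous_comp _ _ _ (fun s => c * (s - z)) smoothstep').
      by apply: cvgMr; apply: cvgB; [exact: cvg_id|exact: cvg_cst].
    exact: smoothstep'_continuous.
  by rewrite d1E => s; apply: cvgB; exact: cs.
- apply: subclosed_compact sub; first exact: closed_closure.
  exact: segment_compact.
- move=> s /sub; rewrite /= !in_itv/= => /andP[xs sy].
  rewrite (lt_le_trans ax xs)/=; apply: le_lt_trans sy _.
  have : c^-1 < b - y by rewrite -div1r ltr_pdivrMr// mulrC.
  lra.
Qed.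

Section Primitive.
Variables (a b : R) (f g : R -> R).
Hypotheses (ab : a < b) (cf : {within `[a, b], continuous f}).
Hypotheses (Lg : L2 a b g) (fg : weak_derivative a b f g).

Let ft := f \o clamp a b.
Let gt := g \_ `]a, b[.

Let ft_cont : continuous ft.
Proof. by apply: comp_clamp_continuous => //; exact: ltW. Qed.

Let gt_int2 : loc_int2 gt. Proof. exact: patch_loc_int2. Qed.

Let gt_int : loc_int gt. Proof. exact: loc_int2_int. Qed.

Lemma weak_derivative_plateau x y c : a < x -> x < y -> y < b -> 0 < c ->
  1 < c * (b - y) ->
  Iint (fun s => ft s * (c * smoothstep' (c * (s - x)))) a b -
  Iint (fun s => ft s * (c * smoothstep' (c * (s - y)))) a b =
  - Iint (fun s => gt s * plateau x y c s) a b.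
Proof.
move=> ax xy yb c0 cb.
have := fg (plateau_test_function ax xy yb c0 cb).
have li z : loc_int (fun s => ft s * (c * smoothstep' (c * (s - z)))).
  apply: loc_intM; first exact: loc_int2_cont.
  apply: loc_int2_cont => s; apply: cvgMr.
  apply: (@continuous_comp _ _ _ (fun s => c * (s - z)) smoothstep').
    by apply: cvgMr; apply: cvgB; [exact: cvg_id|exact: cvg_cst].
  exact: smoothstep'_continuous.
have -> : \int[mu]_(s in `]a, b[) (f s * derive1 (plateau x y c) s) =
   \int[mu]_(s in `]a, b[) (ft s * (c * smoothstep' (c * (s - x))) -
                            ft s * (c * smoothstep' (c * (s - y)))).
  apply: eq_Rintegral => s; rewrite inE/= in_itv/= => /andP[as_ sb].
  have [_ d1] := is_derive_plateau x y c s.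
  by rewrite derive1E d1 /ft/= clamp_id ?(ltW as_) ?(ltW sb)// mulrBr.
have -> : \int[mu]_(s in `]a, b[) (g s * plateau x y c s) =
   \int[mu]_(s in `]a, b[) (gt s * plateau x y c s).
  by apply: eq_Rintegral => s sab; rewrite /gt patchE sab.
rewrite !Iint_oo ?IintB//; last exact: loc_intB.
apply: loc_intM => //; apply: loc_int2_cont; exact: plateau_continuous.
Qed.

(** Let [c] tend to infinity in the plateau identity: the kernels become evaluations of [ft] at [x]
    and [y], and dominated convergence, with bound the absolute value of [gt], handles the other
    side. *)
Lemma weak_derivative_interior x y : a < x -> x < y -> y < b ->
  ft y - ft x = Iint gt x y.
Proof.
move=> ax xy yb.
have h1 := approx_delta ft_cont ax (lt_trans xy yb).
have h2 := approx_delta ft_cont (lt_trans ax xy) yb.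
have h3 : Iint (fun s => gt s * plateau x y k.+1%:R s) a b @[k --> \oo] --> Iint gt x y.
  have [mgt _] := gt_int.
  have m1 (k : nat) : measurable_fun `[a, b] (fun s => (gt s * plateau x y k.+1%:R s)%:E).
    apply/measurable_EFinP; apply: measurable_funM; first exact: measurable_funS mgt.
    apply: measurable_funTS; apply: continuous_measurable_fun; exact: plateau_continuous.
  have m2 : measurable_fun `[a, b] (fun s => (gt s * \1_(`]x, y]) s)%:E).
    apply/measurable_EFinP; apply: measurable_funM; first exact: measurable_funS mgt.
    exact: measurable_indic.
  have cv : \forall s \ae mu, `[a, b]%classic s ->
      (gt s * plateau x y k.+1%:R s)%:E @[k --> \oo] --> (gt s * \1_(`]x, y]) s)%:E.
    apply: aeW => s _; apply: cvg_EFin; first by apply: nearW.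
    by apply: cvgMr; exact: plateau_cvg.
  have dom : \forall s \ae mu, forall k : nat, `[a, b]%classic s ->
      (`|(gt s * plateau x y k.+1%:R s)%:E| <= `|gt s|%:E)%E.
    apply: aeW => s k _; rewrite lee_fin normrM ler_piMr// plateau_norm_le1//.
  have [_ ia] := loc_int_norm gt_int.
  have [_ _ lim_] := @dominated_convergence _ _ R mu `[a, b] (measurable_itv _)
    _ _ _ m1 m2 cv (ia a b) dom.
  have E : (\int[mu]_(s in `[a, b]) (gt s * \1_(`]x, y]) s)%:E)%E = (Iint gt x y)%:E.
    have [_ ig] := gt_int.
    have sxy : `]x, y]%classic `<=` `[x, y]%classic.
      by move=> s /=; rewrite !in_itv/= => /andP[/ltW -> ->].
    rewrite /Iint /Rintegral fineK; last exact: integrable_fin_num (ig x y).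
    rewrite -(@integral_itv_obnd_cbnd _ x); last first.
      by apply/measurable_EFinP; exact: measurable_funS mgt.
    rewrite [in RHS](_ : `]x, y]%classic = `[a, b]%classic `&` `]x, y]%classic);
      last first.
      rewrite setIidr// => s /=; rewrite !in_itv/= => /andP[xs sy].
      by rewrite (le_trans (ltW ax) (ltW xs)) (le_trans sy (ltW yb)).
    rewrite integral_mkcondr; apply: eq_integral => s _.
    by rewrite patchE indicE; case: ifP => _; rewrite ?mulr1 ?mulr0.
  rewrite E in lim_.
  exact: (fine_cvg lim_).
have h4 : - Iint (fun s => gt s * plateau x y k.+1%:R s) a b @[k --> \oo] --> - Iint gt x y.
  exact: cvgN.
have h5 : - Iint (fun s => gt s * plateau x y k.+1%:R s) a b @[k --> \oo] --> ft x - ft y.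
  apply: cvg_trans (cvgB h1 h2); apply: near_eq_cvg; near=> k.
  rewrite !fctE weak_derivative_plateau//.
  (* Half the distance turns the nonstrict bound of [near_scale_ge1] into the strict one
     required. *)
  have : 1 <= k.+1%:R * ((b - y) / 2).
    by near: k; apply: near_scale_ge1; rewrite divr_gt0// subr_gt0.
  rewrite mulrA ler_pdivlMr// mul1r; apply: lt_le_trans.
  by rewrite ltr1n.
have E : - Iint gt x y = ft x - ft y := cvg_unique (@norm_hausdorff _ _) h4 h5.
by rewrite -[RHS]opprK E opprB.
Unshelve. all: by end_near. Qed.

(** By the interior case [D] is constant on []a, b[]; continuity up to the endpoints and the mean
    value theorem extend this to [[a, b]]. *)
Lemma weak_derivative_Iint s t : s <= t -> ft t - ft s = Iint gt s t.
Proof.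
pose G x := Iint gt a x.
pose D x := ft x - G x.
have [_ ig] := gt_int.
have cD : {within `[a, b], continuous D}.
  have cG := parameterized_integral_continuous (ltW ab) (ig a b).
  by move=> x; apply: cvgB; [exact: (continuous_subspaceT ft_cont)|exact: cG].
have dD (x : R) : x \in `]a, b[ -> is_derive x 1 D 0.
  rewrite in_itv/= => /andP[ax xb]; apply: is_derive_increments => e e0.
  have [N Na Nb] : [/\ 0 < Num.min (x - a) (b - x), Num.min (x - a) (b - x) <= x - a
      & Num.min (x - a) (b - x) <= b - x].
    by rewrite lt_min !ge_min !lexx orbT !subr_gt0 ax xb.
  have H := near_dist_lt x N.
  apply: filterS H => y xy; rewrite scaler0 subr0.
  suff -> : D y = D x by rewrite subrr normr0 mulr_ge0// ltW.
  have Dlt u v : a < u -> u < v -> v < b -> D u = D v.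
    move=> au uv vb; have := weak_derivative_interior au uv vb.
    by rewrite /D /G (Iint_chasles gt_int (ltW au) (ltW uv)); lra.
  have [yx|yx|->//] := ltgtP y x; last first.
    by apply/esym; apply: Dlt => //; move: xy; rewrite ltr0_norm; lra.
  by apply: Dlt => //; move: xy; rewrite gtr0_norm; lra.
have Dc u v : a <= u -> u <= v -> v <= b -> D u = D v.
  move=> au uv vb.
  have suv (x : R) : x \in `]u, v[ -> is_derive x 1 D 0.
    rewrite in_itv/= => /andP[ux xv]; apply: dD; rewrite in_itv/=.
    by rewrite (le_lt_trans au ux) (lt_le_trans xv vb).
  have cuv : {within `[u, v], continuous D}.
    apply: continuous_subspaceW cD => x /=; rewrite !in_itv/= => /andP[ux xv].
    by rewrite (le_trans au ux) (le_trans xv vb).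
  have [c _] := MVT_segment uv suv cuv.
  by rewrite mul0r => /eqP; rewrite subr_eq0 => /eqP.
move=> st; pose c := clamp a b.
have [as_ sb] : a <= c s /\ c s <= b by apply/andP; exact: clamp_itv (ltW ab).
have [at_ tb] : a <= c t /\ c t <= b by apply/andP; exact: clamp_itv (ltW ab).
have cst : c s <= c t by exact: clamp_homo.
have := Dc _ _ as_ cst tb.
have ftc x : ft (c x) = ft x.
  by rewrite /ft/= /c (clamp_id (clamp_itv x (ltW ab))).
rewrite /D /G (Iint_chasles gt_int as_ cst) !ftc.
(* [gt] vanishes outside []a, b[], where alone the two segments can differ. *)
suff -> : Iint gt (c s) (c t) = Iint gt s t by lra.
rewrite /Iint -!(Rintegral_mkcondr mu); congr Rintegral.
have H x : x \in `]a, b[ -> (x \in `[c s, c t]) = (x \in `[s, t]).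
  rewrite !in_itv/= => /andP[ax xb]; rewrite /c /clamp ge_max le_max ge_min le_min.
  by rewrite (ltW ax) (leNgt b x) xb (leNgt x a) ax (ltW xb).
by apply/seteqP; split => x /= [h xab]; split => //; move: h; rewrite H.
Qed.

End Primitive.
End WeakDerivative.

(** Pairs violating the bound at distance [k.+1%:R^-1] have a common ultralimit in [K], where
    continuity of [h] closes the gap. *)
Lemma compact_uniform_continuity {R : realType} {V V' : normedModType R}
    (K : set V) (h : V -> V') (e : R) : compact K -> continuous h -> 0 < e ->
  exists2 r, 0 < r & forall x y, K x -> K y -> `|x - y| <= r -> `|h x - h y| <= e.
Proof.
move=> Kc ch e0; apply: contrapT => nr.
have k0 (k : nat) : 0 < k.+1%:R^-1 :> R by rewrite invr_gt0.
have /choice[z Hz] : forall k : nat, exists z : V * V,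
    [/\ K z.1, K z.2, `|z.1 - z.2| <= k.+1%:R^-1 & e < `|h z.1 - h z.2|].
  move=> k; apply: contrapT => nz; apply: nr; exists k.+1%:R^-1 => // x y Kx Ky xy.
  by rewrite leNgt; apply/negP => exy; apply: nz; exists (x, y).
have [U [UU sU]] := ultraFilterLemma (@eventually_filter).
have Kz k : K (z k).1 by have [] := Hz k.
have [x _ zx] := ultra_cvg_in_compact UU Kc Kz.
have zy : (z k).2 @[k --> U] --> x.
  have d0 : ((z k).1 - (z k).2) @[k --> U] --> (0 : V).
    apply/cvgr0Pnorm_le => d d0.
    have : U [set k : nat | k.+1%:R^-1 < d].
      by apply: sU; exact: near_infty_natSinv_lt (PosNum d0).
    by apply: filterS => k /ltW; have [_ _ + _] := Hz k => /le_trans; exact.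
  rewrite (_ : (fun k => (z k).2) = fun k => (z k).1 - ((z k).1 - (z k).2)).
    by rewrite -[x in _ --> x]subr0; exact: cvgB.
  by apply/funext => k; rewrite subKr.
have c : `|h (z k).1 - h (z k).2| @[k --> U] --> `|h x - h x|.
  by apply: cvg_norm; apply: cvgB; apply: continuous_cvg => //; exact: ch.
have : e <= `|h x - h x|.
  by apply: (cvgr_to_ge c); apply: filterE => k; have [_ _ _ /ltW] := Hz k.
by rewrite subrr normr0 leNgt e0.
Qed.

(** * Additive functions of intervals *)

Section Chaining.
Context {R : realType}.
Local Notation mu := (@lebesgue_measure R).

Lemma Iint_deviation (h : R -> R) (c e s t : R) : s <= t -> loc_int h ->
  (forall r, s <= r <= t -> `|h r - c| <= e) ->
  `|Iint h s t - (t - s) * c| <= e * (t - s).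
Proof.
move=> st lh hc.
have lc (k : R) : loc_int (fun=> k) by apply: loc_int_cont => x; exact: cvg_cst.
have -> : (t - s) * c = Iint (fun=> c) s t by rewrite Iint_cst// mulrC.
rewrite -IintB//; apply: le_trans (Iint_norm _ _ (loc_intB lh (lc c))) _.
rewrite -Iint_cst//; apply: Iint_le => //.
by apply: loc_int_norm; exact: loc_intB.
Qed.

(** Adding the local bounds over steps of length [r] gives a global bound by [e * G S T], for every
    [e > 0]. This is a zero-derivative principle without pointwise derivatives. *)
Lemma chained_increments (H G : R -> R -> R) (S T : R) :
  (forall r s t, r <= s -> s <= t -> H r t = H r s + H s t) ->
  (forall r s t, r <= s -> s <= t -> G r t = G r s + G s t) ->
  (forall e, 0 < e -> exists2 r, 0 < r & forall s t, S <= s -> s <= t -> t <= T ->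
    t - s <= r -> `|H s t| <= e * G s t) ->
  S <= T -> H S T = 0.
Proof.
move=> addH addG loc ST.
have Hle e : 0 < e -> `|H S T| <= e * G S T.
  move=> e0; have [r r0 Hr] := loc e e0.
  have step (k : nat) s t : S <= s -> s <= t -> t <= T -> t - s <= k.+1%:R * r ->
      `|H s t| <= e * G s t.
    elim: k s t => [|k IH] s t Ss st tT; first by rewrite mul1r; exact: Hr.
    move=> tsk; have [tr|tr] := leP (t - s) r; first exact: Hr.
    have sr : s <= s + r by rewrite lerDl ltW.
    have rt : s + r <= t by lra.
    rewrite (addH _ _ _ sr rt) (addG _ _ _ sr rt) mulrDr.
    apply: le_trans (ler_normD _ _) _; apply: lerD.
      by apply: Hr => //; lra.
    apply: IH => //; first by lra.
    by move: tsk; rewrite -[k.+2]addn1 natrD mulrDl mul1r; lra.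
  pose k := Num.truncn ((T - S) / r).
  apply: (step k) => //; rewrite -ler_pdivrMr//; apply: ltW.
  exact: truncnS_gt.
apply/eqP; rewrite -normr_le0; apply/ler_addgt0Pr => e e0; rewrite add0r.
have G1 : 0 < `|G S T| + 1 by rewrite ltr_wpDl.
have := Hle (e / (`|G S T| + 1)) (divr_gt0 e0 G1) => /le_trans; apply.
rewrite mulrAC ler_pdivrMr// ler_pM2l//.
by apply: le_trans (ler_norm _) _; rewrite lerDl.
Qed.

End Chaining.

(** * Energy balance along curves with square integrable acceleration *)

Section Curves.
Context {R : realType} {n : nat}.
Local Notation X := 'cV[R]_n.+1.
Variables (A B : 'M[R]_n.+1) (f : X -> R).
Hypotheses (A_spd : sym_posdef A) (B_spd : sym_posdef B).
Hypothesis f_diff : forall x, differentiable f x.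
Hypothesis gradf_cont : continuous (grad f).

(* [W] is of class C^1 with velocity [P], and [Q] is the locally square
   integrable derivative of [P]. *)
Definition curve (W P Q : R -> X) : Prop :=
  [/\ continuous W, continuous P, forall i, loc_int2 (fun s => Q s i 0),
      forall i s t, s <= t -> W t i 0 - W s i 0 = Iint (fun r => P r i 0) s t
    & forall i s t, s <= t -> P t i 0 - P s i 0 = Iint (fun r => Q r i 0) s t].

Definition residual (W P Q : R -> X) (s : R) : X := grad f (W s) + A *m Q s + B *m P s.

Definition residual_density (W P Q : R -> X) (s : R) : R :=
  2^-1 * dot (residual W P Q s) (invmx B *m residual W P Q s).

Lemma loc_int2_coord (h : R -> X) i : continuous h -> loc_int2 (fun s => h s i 0).
Proof.
move=> ch; apply: loc_int2_cont => s.
by apply: (@cvg_comp _ _ _ h (fun M : X => M i 0) _ _ _ (ch s)); exact: coord_continuous.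
Qed.

Lemma loc_int2_coordB (h k : R -> X) i : loc_int2 (fun s => h s i 0) ->
  loc_int2 (fun s => k s i 0) -> loc_int2 (fun s => (h s - k s) i 0).
Proof.
move=> lh /(loc_int2Z (-1)) /(loc_int2D lh); congr loc_int2.
by apply/funext => s; rewrite !mxE mulN1r.
Qed.

Lemma loc_int2_mulmx (h : R -> X) (C : 'M[R]_n.+1) i :
  (forall j, loc_int2 (fun s => h s j 0)) -> loc_int2 (fun s => (C *m h s) i 0).
Proof.
move=> lh; under eq_fun do rewrite mxE.
by apply: loc_int2_sum => j; exact: loc_int2Z.
Qed.

Lemma loc_int_dot (h k : R -> X) : (forall i, loc_int2 (fun s => h s i 0)) ->
  (forall i, loc_int2 (fun s => k s i 0)) -> loc_int (fun s => dot (h s) (k s)).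
Proof. by move=> lh lk; apply: loc_int_sum => i; exact: loc_intM. Qed.

Lemma Iint_mulmx (h : R -> X) (C : 'M[R]_n.+1) i s t :
  (forall j, loc_int2 (fun s => h s j 0)) ->
  Iint (fun s => (C *m h s) i 0) s t = (C *m \col_j Iint (fun s => h s j 0) s t) i 0.
Proof.
move=> lh; rewrite mxE; under eq_fun do rewrite mxE.
rewrite Iint_sum; last by move=> j; apply: loc_intZ; exact: loc_int2_int.
by apply: eq_bigr => j _; rewrite IintZ ?mxE//; exact: loc_int2_int.
Qed.

Section Curve.
Variables W P Q : R -> X.
Hypothesis cv : curve W P Q.

Let W_cont : continuous W. Proof. by case: cv. Qed.
Let P_cont : continuous P. Proof. by case: cv. Qed.
Let Q_int i : loc_int2 (fun s => Q s i 0). Proof. by case: cv. Qed.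
Let P_int i : loc_int2 (fun s => P s i 0). Proof. exact: loc_int2_coord. Qed.

Let gradW_cont : continuous (fun s => grad f (W s)).
Proof. by move=> s; apply: cvg_gradf => //; exact: W_cont. Qed.

Lemma residual_int i : loc_int2 (fun s => residual W P Q s i 0).
Proof.
have -> : (fun s => residual W P Q s i 0) =
    (fun s => grad f (W s) i 0 + (A *m Q s) i 0 + (B *m P s) i 0).
  by apply/funext => s; rewrite [LHS]mxE [X in X + _]mxE.
apply: loc_int2D; last exact: loc_int2_mulmx.
by apply: loc_int2D; [exact: loc_int2_coord|exact: loc_int2_mulmx].
Qed.

Lemma residual_density_int : loc_int (residual_density W P Q).
Proof.
apply: loc_intZ; apply: loc_int_dot; first exact: residual_int.
by move=> i; apply: loc_int2_mulmx; exact: residual_int.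
Qed.

Lemma curve_velocity (s : R) : is_derive s 1 W (P s).
Proof.
have [_ _ _ WP _] := cv.
apply: is_derive_increments => e e0.
have /cvgrPdist_le/(_ e e0)/nbhs_ballP[d d0 Hd] := @P_cont s.
have N : \forall t \near s, `|s - t| < d by exact: near_dist_lt.
apply: filterS N => t std.
have Pd r i : `|s - r| < d -> `|P r i 0 - P s i 0| <= e.
  move=> sr; apply: le_trans (Hd r sr); rewrite distrC.
  by have := coord_le_mx_norm (P s - P r) i 0; rewrite !mxE.
apply: mx_norm_le; first by rewrite mulr_ge0// ltW.
move=> i j; rewrite ord1 !mxE.
have [st|/ltW ts] := leP s t.
  rewrite WP// (ger0_norm (_ : 0 <= t - s)) ?subr_ge0//.
  apply: Iint_deviation => //; first exact: loc_int2_int.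
  move=> r /andP[sr rt]; apply: Pd; move: std.
  by rewrite distrC ger0_norm ?subr_ge0// distrC ger0_norm ?subr_ge0//; lra.
rewrite distrC (ler0_norm (_ : t - s <= 0)) ?subr_le0//.
have -> : (t - s) * P s i 0 - (W t i 0 - W s i 0) = (W s i 0 - W t i 0) - (s - t) * P s i 0.
  by ring.
rewrite opprB.
rewrite WP//; apply: Iint_deviation => //; first exact: loc_int2_int.
move=> r /andP[tr rs]; apply: Pd; move: std.
by rewrite ger0_norm ?subr_ge0// ger0_norm ?subr_ge0//; lra.
Qed.

Lemma curve_potential s t : s <= t ->
  f (W t) - f (W s) = Iint (fun r => dot (grad f (W r)) (P r)) s t.
Proof.
move=> st; apply/esym.
apply: (@Iint_FTC _ (fun r => dot (grad f (W r)) (P r)) (fun r => f (W r))) => //.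
  by move=> r; apply: cvg_dot; [exact: gradW_cont|exact: P_cont].
by move=> r; apply: is_derive_comp_grad => //; exact: curve_velocity.
Qed.

Lemma curve_momentum s t : s <= t ->
  A *m (P t - P s) = \col_i Iint (fun r => (A *m Q r) i 0) s t.
Proof.
have [_ _ _ _ PQ] := cv; move=> st; apply/matrixP => i j.
rewrite ord1 [RHS]mxE Iint_mulmx//; congr ((_ *m _) _ _).
by apply/matrixP => k l; rewrite ord1 !mxE PQ.
Qed.

(* The chain rule for the absolutely continuous momentum: on a short interval
   the kinetic energy increment is the integral of [A Q] against the average of
   the end values of [P]. *)
Lemma curve_kinetic s t : s <= t ->
  2^-1 * dot (P t) (A *m P t) - 2^-1 * dot (P s) (A *m P s) =
  Iint (fun r => dot (P r) (A *m Q r)) s t.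
Proof.
have AQ_int i : loc_int2 (fun r => (A *m Q r) i 0) by exact: loc_int2_mulmx.
have PAQ_int : loc_int (fun r => dot (P r) (A *m Q r)) by exact: loc_int_dot.
pose H s t := 2^-1 * dot (P t) (A *m P t) - 2^-1 * dot (P s) (A *m P s) -
  Iint (fun r => dot (P r) (A *m Q r)) s t.
pose G s t := Iint (fun r => \sum_i `|(A *m Q r) i 0|) s t.
have G_int : loc_int (fun r => \sum_i `|(A *m Q r) i 0|).
  by apply: loc_int_sum => i; apply: loc_int_norm; exact: loc_int2_int.
move=> st; suff : H s t = 0 by rewrite /H; lra.
apply: (@chained_increments _ H G s t) => //.
- by move=> r s' t' rs' st'; rewrite /H (Iint_chasles PAQ_int rs' st'); ring.
- by move=> r s' t' rs' st'; exact: Iint_chasles.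
move=> e e0.
have [r r0 Hr] := @compact_uniform_continuity R R^o X `[s, t]%classic P e
  (@segment_compact _ _ _) P_cont e0.
exists r => // s' t' ss' st' tt' tsr.
have close x : s' <= x <= t' -> `|P t' - P x| <= e /\ `|P s' - P x| <= e.
  move=> /andP[sx xt]; split; apply: Hr; rewrite /= ?in_itv/=.
  - by rewrite tt' (le_trans ss' st').
  - by rewrite (le_trans ss' sx) (le_trans xt tt').
  - by rewrite ger0_norm ?subr_ge0//; lra.
  - by rewrite ss' (le_trans st' tt').
  - by rewrite (le_trans ss' sx) (le_trans xt tt').
  - by rewrite distrC ger0_norm ?subr_ge0//; lra.
pose m : X := 2^-1 *: (P t' + P s').
have lm i : loc_int2 (fun _ : R => m i 0) by apply: loc_int2_cont => x; exact: cvg_cst.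
(* By symmetry of [A] the kinetic increment is exactly [<m, A (P t' - P s')>], so only the
   oscillation of [P] around [m] is left. *)
have HE : H s' t' = Iint (fun r => dot (m - P r) (A *m Q r)) s' t'.
  have -> : (fun r => dot (m - P r) (A *m Q r)) =
      (fun r => dot m (A *m Q r) - dot (P r) (A *m Q r)).
    by apply/funext => x; rewrite dotDl dotNl.
  rewrite IintB//; last exact: loc_int_dot.
  congr (_ - _).
  have -> : Iint (fun r => dot m (A *m Q r)) s' t' = dot m (A *m (P t' - P s')).
    rewrite curve_momentum// /dot Iint_sum; last by move=> i; exact: loc_intM.
    by apply: eq_bigr => i _; rewrite IintZ ?mxE//; exact: loc_int2_int.
  rewrite /m dotZl mulmxBr !(dotDl, dotDr, dotNr) (posdef_dotC A_spd (P s') (P t')).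
  by ring.
have ld : loc_int (fun r => dot (m - P r) (A *m Q r)).
  by apply: loc_int_dot => // i; apply: (@loc_int2_coordB (fun=> m)).
rewrite HE; apply: le_trans (Iint_norm _ _ ld) _.
rewrite /G -IintZ//; apply: Iint_le.
- exact: loc_int_norm.
- exact: loc_intZ.
- move=> x /close[h1 h2]; rewrite mulr_sumr.
  apply: le_trans (ler_norm_sum _ _ _) _; apply: ler_sum => i _.
  rewrite normrM; apply: ler_wpM2r => //.
  apply: le_trans (coord_le_mx_norm _ i 0) _.
  have -> : m - P x = 2^-1 *: ((P t' - P x) + (P s' - P x)).
    rewrite /m addrACA -opprD -mulr2n scalerBr; congr (_ - _).
    have -> : P x *+ 2 = (2 : R) *: P x by rewrite scaler_nat.
    by rewrite scalerA mulVf ?scale1r// pnatr_eq0.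
  rewrite normrZ ger0_norm//.
  by have := ler_normD (P t' - P x) (P s' - P x); lra.
Qed.

Lemma curve_energy s t : s <= t ->
  energy A f (W t) (P t) - energy A f (W s) (P s) =
  Iint (fun r => dot (residual W P Q r - B *m P r) (P r)) s t.
Proof.
move=> st; have := curve_potential st; have := curve_kinetic st.
have l1 : loc_int (fun r => dot (grad f (W r)) (P r)).
  by apply: loc_int_dot => // i; exact: loc_int2_coord.
have l2 : loc_int (fun r => dot (P r) (A *m Q r)).
  by apply: loc_int_dot => // i; exact: loc_int2_mulmx.
have -> : (fun r => dot (residual W P Q r - B *m P r) (P r)) =
    (fun r => dot (grad f (W r)) (P r) + dot (P r) (A *m Q r)).
  by apply/funext => r; rewrite /residual addrK dotDl (dotC (A *m _)).
by rewrite IintD// /energy => <- <-; ring.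
Qed.

(** The square completed pointwise: the cross term is the integrand of [curve_energy]. *)
Lemma residual_densityE s :
  residual_density W P Q s =
  2^-1 * (dot (grad f (W s) + A *m Q s) (invmx B *m (grad f (W s) + A *m Q s)) +
     dot (P s) (B *m P s)) + dot (residual W P Q s - B *m P s) (P s).
Proof.
rewrite /residual_density /residual addrK; move: (grad f (W s) + A *m Q s) => z.
rewrite mulmxDr mulKmx ?posdef_unitmx// !(dotDl, dotDr).
rewrite (posdef_dotC (posdef_invmx B_spd) (B *m P s) z) mulKmx ?posdef_unitmx//.
by rewrite (dotC (B *m P s)); field.
Qed.

(** The half Lagrangian in the previous identity is nonnegative. Integration bounds every gain of
    energy by the integral of the density. *)
Lemma residual_density_ge s :
  dot (residual W P Q s - B *m P s) (P s) <= residual_density W P Q s.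
Proof.
rewrite residual_densityE lerDr mulr_ge0// addr_ge0//.
  exact/posdef_ge0/posdef_invmx.
exact: posdef_ge0.
Qed.

Lemma residual_density_ge0 s : 0 <= residual_density W P Q s.
Proof. by rewrite mulr_ge0//; exact/posdef_ge0/posdef_invmx. Qed.

Lemma curve_energy_le s t : s <= t -> energy A f (W t) (P t) <=
  energy A f (W s) (P s) + Iint (residual_density W P Q) s t.
Proof.
move=> st; rewrite addrC -lerBlDr curve_energy//; apply: Iint_le.
- apply: loc_int_dot => // i; apply: loc_int2_coordB; first exact: residual_int.
  exact: loc_int2_mulmx.
- exact: residual_density_int.
- by move=> x _; exact: residual_density_ge.
Qed.

End Curve.
End Curves.

(** * From small residual to pseudo-orbit *)

Section CurveToPseudoOrbit.
Context {R : realType} {n : nat}.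
Local Notation X := 'cV[R]_n.+1.
Variables (A B : 'M[R]_n.+1) (f : X -> R).
Hypotheses (A_spd : sym_posdef A) (B_spd : sym_posdef B).
Hypothesis f_diff : forall x, differentiable f x.
Hypothesis gradf_cont : continuous (grad f).

(** From L^2 to L^1 by the weighted inequality |z| <= d/2 + |z|^2/(2d), with |z|^2 at most [2 * be]
    times the density. Length at most 1 gives [d / 2] for the constant, and [eps] gives [d / 2] for
    the rest. *)
Lemma residual_Iint_le (d : R) : 0 < d -> exists2 eps, 0 < eps &
  forall W P Q i s t, curve W P Q -> s <= t -> t - s <= 1 ->
    Iint (residual_density A B f W P Q) s t <= eps ->
    `|Iint (fun r => residual A B f W P Q r i 0) s t| <= d.
Proof.
move=> d0; pose be := `|invmx (invmx B)|.
have be0 : 0 <= be by exact: normr_ge0.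
exists (d ^+ 2 / (2 * (be + 1))).
  by rewrite divr_gt0 ?exprn_gt0// mulr_gt0// ltr_wpDl.
move=> W P Q i s t cv st ts1; rewrite ler_pdivlMr ?mulr_gt0 ?ltr_wpDl// => Ieps.
have rI := residual_int A B gradf_cont cv.
have dI := residual_density_int A B gradf_cont cv.
set z := residual A B f W P Q in rI *; set y := residual_density A B f W P Q in dI Ieps.
have lc (k : R) : loc_int (fun=> k) by apply: loc_int_cont => x; exact: cvg_cst.
have zi : loc_int (fun r => z r i 0) by apply: loc_int2_int; exact: rI.
apply: le_trans (Iint_norm _ _ zi) _.
apply: (@le_trans _ _ (Iint (fun r => d / 2 + be / d * y r) s t)).
  apply: Iint_le; first exact: loc_int_norm.
    by apply: loc_intD => //; exact: loc_intZ.
  move=> r _; have := posdef_norm_le (posdef_invmx B_spd) (z r).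
  have yE : dot (z r) (invmx B *m z r) = 2 * y r by rewrite /y /residual_density -/z; field.
  rewrite yE -/be => h1; have h2 := coord_le_mx_norm (z r) i 0.
  apply: le_trans h2 _.
  have h3 : 2 * (`|z r| * d) <= d ^+ 2 + `|z r| ^+ 2.
    by have := sqr_ge0 (`|z r| - d); nra.
  rewrite -(ler_pM2r d0).
  have -> : (d / 2 + be / d * y r) * d = d ^+ 2 / 2 + be * y r by field; rewrite gt_eqF.
  move: h1 h3; move: (`|z r|) (y r) => a b; nra.
rewrite IintD//; last exact: loc_intZ.
rewrite Iint_cst// IintZ//.
have y0 : 0 <= Iint y s t by apply: Iint_ge0 => r; exact: residual_density_ge0.
have h1 : be / d * Iint y s t <= d / 2.
  rewrite mulrAC ler_pdivrMr//; move: Ieps y0; move: (Iint y s t) => I; nra.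
have h2 : d / 2 * (t - s) <= d / 2 by rewrite ler_piMr// divr_ge0// ltW.
by apply: le_trans (lerD h2 h1) _; rewrite -splitr.
Qed.

(** [rho] is built only from the force bound [K] and the uniform continuity of [grad f] on the ball,
    so it serves all curves and all errors; [dl] enters through [eps] alone. *)
Lemma curve_pseudo_orbit (M : R) : 0 <= M -> exists rho : R -> R,
  [/\ forall e, 0 < e -> 0 < rho e, forall e, rho e <= 1
    & forall dl, 0 < dl -> exists2 eps, 0 < eps & forall W P Q : R -> X,
      curve W P Q -> (forall s, `|W s| <= M) -> (forall s, `|P s| <= M) ->
      (forall s t, s <= t -> Iint (residual_density A B f W P Q) s t <= eps) ->
      pseudo_orbit A B f rho M dl W P].
Proof.
move=> M0.
have [K HK] := force_bounded B M gradf_cont.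
have K0 : 0 <= K by apply: le_trans (HK 0 0 _ _); rewrite ?normr0.
pose a0 := n.+1%:R * `|invmx A|; have a00 : 0 <= a0 by rewrite mulr_ge0.
pose b0 := n.+1%:R * `|B|; have b00 : 0 <= b0 by rewrite mulr_ge0.
have /choice[rho Hrho] : forall e : R, exists r : R, r <= 1 /\ (0 < e ->
    [/\ 0 < r, a0 * (K * r) <= e, b0 * (a0 * (K * r)) <= e / 2
      & forall x y : X, `|x| <= M -> `|y| <= M -> `|x - y| <= M * r ->
         `|grad f x - grad f y| <= e / 2]).
  move=> e; have [e0|e0] := leP e 0; first by exists 1; split => //; rewrite ltNge e0.
  have e20 : 0 < e / 2 by rewrite divr_gt0.
  have [r1 r10 Hr1] :=
    compact_uniform_continuity (@col_ball_compact R n.+1 M) gradf_cont e20.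
  pose c := a0 * K + 2 * (b0 * (a0 * K)) + 1.
  have ak0 : 0 <= a0 * K by rewrite mulr_ge0.
  have bak0 : 0 <= b0 * (a0 * K) by rewrite mulr_ge0.
  have c0 : 0 < c by rewrite /c; lra.
  have M1 : 0 < M + 1 by lra.
  pose r := Num.min 1 (Num.min (e / c) (r1 / (M + 1))).
  have r0 : 0 < r by rewrite !lt_min ltr01 !divr_gt0.
  have rc : r * c <= e by rewrite -ler_pdivlMr// /r !ge_min lexx !orbT.
  have rM : r * (M + 1) <= r1 by rewrite -ler_pdivlMr// /r !ge_min lexx !orbT.
  have r_ge0 := ltW r0.
  exists r; split; first by rewrite /r ge_min lexx.
  move=> _; split => //.
  - have := mulr_ge0 r_ge0 bak0; move: rc; rewrite /c; nra.
  - have := mulr_ge0 r_ge0 ak0; move: rc; rewrite /c; nra.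
  - move=> x y xM yM xy; apply: Hr1 => //; apply: le_trans xy _; nra.
exists rho; split.
- by move=> e /(Hrho e).2[].
- by move=> e; exact: (Hrho e).1.
move=> dl dl0.
(* The budget is [d] for the integrated Newton law, [a0 * d] for the resulting error in [P], and
   [b0 * a0 * d] for its effect on the force; [dE] adds them up. *)
pose d := dl / (1 + a0 + b0 * a0).
have ba0 : 0 <= b0 * a0 by rewrite mulr_ge0.
have den0 : 0 < 1 + a0 + b0 * a0 by lra.
have d0 : 0 < d by rewrite divr_gt0.
have dE : d + a0 * d + b0 * a0 * d = dl by rewrite /d; field; lra.
have [eps1 eps10 Heps1] := residual_Iint_le d0.
exists (Num.min eps1 dl); first by rewrite lt_min eps10.
move=> W P Q cv WM PM Ieps.
have Ieps1 s t : s <= t -> Iint (residual_density A B f W P Q) s t <= eps1.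
  by move=> /Ieps; rewrite le_min => /andP[].
have [Wc Pc Qi WP PQ] := cv.
pose F r := force B f (W r) (P r).
have Fc : continuous F.
  by move=> r; apply: cvg_force => //; [exact: Wc|exact: Pc].
have Fi i : loc_int (fun r => F r i 0) by exact/loc_int2_int/loc_int2_coord.
have Pi i : loc_int (fun r => P r i 0) by exact/loc_int2_int/loc_int2_coord.
have FK r : `|F r| <= K by exact: HK.
(* Newton's law integrated over [s, t], up to the integral of the residual. *)
have newton i s t : s <= t -> t - s <= 1 ->
    `|(A *m (P t - P s)) i 0 + Iint (fun r => F r i 0) s t| <= d.
  move=> st ts1; rewrite (curve_momentum A cv st) mxE -IintD//; last first.
    by apply: loc_int2_int; exact: loc_int2_mulmx.
  have -> : (fun r => (A *m Q r) i 0 + F r i 0) = (fun r => residual A B f W P Q r i 0).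
    by apply/funext => r; rewrite /F /force /residual [grad f _ + _]addrC -addrA
      [grad f _ + _]addrC [RHS]mxE.
  by apply: Heps1 => //; exact: Ieps1.
have dP s t : s <= t -> t - s <= 1 -> `|P t - P s| <= a0 * (K * (t - s)) + a0 * d.
  move=> st ts1; have ts0 : 0 <= t - s by rewrite subr_ge0.
  have -> : P t - P s = invmx A *m (A *m (P t - P s)) by rewrite mulKmx// posdef_unitmx.
  apply: le_trans (mulmx_norm_le _ _) _; rewrite -mulrDr; apply: ler_wpM2l => //.
  apply: mx_norm_le.
    by apply: addr_ge0; [exact: mulr_ge0|exact: ltW].
  move=> i j; rewrite ord1.
  have h1 := newton i _ _ st ts1.
  have h2 : `|Iint (fun r => F r i 0) s t| <= K * (t - s).
    apply: le_trans (Iint_norm _ _ (Fi i)) _; rewrite -Iint_cst//.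
    apply: Iint_le; first exact: loc_int_norm.
      by apply: loc_int_cont => x; exact: cvg_cst.
    by move=> r _; apply: le_trans (coord_le_mx_norm _ i 0) _.
  have := ler_normB ((A *m (P t - P s)) i 0 + Iint (fun r => F r i 0) s t)
    (Iint (fun r => F r i 0) s t).
  by rewrite addrK; lra.
have dW s t : s <= t -> `|W t - W s| <= M * (t - s).
  move=> st; have ts0 : 0 <= t - s by rewrite subr_ge0.
  apply: mx_norm_le; first by rewrite mulr_ge0.
  move=> i j; rewrite ord1 !mxE WP//.
  apply: le_trans (Iint_norm _ _ (Pi i)) _; rewrite -Iint_cst//.
  apply: Iint_le; first exact: loc_int_norm.
    by apply: loc_int_cont => x; exact: cvg_cst.
  by move=> r _; apply: le_trans (coord_le_mx_norm _ i 0) _.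
split => //.
  move=> s t st; apply: le_trans (curve_energy_le A_spd B_spd f_diff gradf_cont cv st) _.
  by rewrite lerD2l; have := Ieps s t st; rewrite le_min => /andP[].
move=> e s t e0 /andP[st ts].
have [rho1 /(_ e0) [r0 ra rb rg]] := Hrho e.
have ts0 : 0 <= t - s by rewrite subr_ge0.
have tsr : t - s <= rho e by lra.
have ts1 : t - s <= 1 by lra.
have ba_d : 0 <= b0 * a0 * d by rewrite mulr_ge0// ltW.
have a_d : 0 <= a0 * d by rewrite mulr_ge0// ltW.
have dPs r : s <= r <= t -> `|P r - P s| <= a0 * (K * rho e) + a0 * d.
  move=> /andP[sr rt]; apply: le_trans (dP s r sr _) _; first by lra.
  by rewrite lerD2r ler_wpM2l// ler_wpM2l//; lra.
split; (apply: mx_norm_le; last move=> i j).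
- by apply: addr_ge0; [apply: mulr_ge0 => //|]; exact: ltW.
- rewrite ord1 !mxE WP//.
  have /le_trans -> // : `|Iint (fun r => P r i 0) s t - (t - s) * P s i 0| <=
      (e + a0 * d) * (t - s).
    apply: Iint_deviation => // r sr; have := coord_le_mx_norm (P r - P s) i 0.
    by rewrite !mxE => /le_trans -> //; apply: le_trans (dPs r sr) _; lra.
  have := ler_wpM2l a_d ts1; lra.
- by apply: addr_ge0; [apply: mulr_ge0 => //|]; exact: ltW.
- have -> : (A *m (P t - P s) + (t - s) *: force B f (W s) (P s)) i j =
      (A *m (P t - P s)) i 0 + (t - s) * F s i 0.
    by rewrite ord1 mxE [X in _ + X = _]mxE.
  have h1 := newton i _ _ st ts1.
  have h2 : `|Iint (fun r => F r i 0) s t - (t - s) * F s i 0| <=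
      (e + b0 * a0 * d) * (t - s).
    apply: Iint_deviation => // r sr; have := coord_le_mx_norm (F r - F s) i 0.
    rewrite mxE [(- F s) i 0]mxE => /le_trans -> //.
    have -> : F r - F s = B *m (P r - P s) + (grad f (W r) - grad f (W s)).
      by rewrite /F /force mulmxBr opprD addrACA.
    apply: le_trans (ler_normD _ _) _.
    have g1 : `|grad f (W r) - grad f (W s)| <= e / 2.
      case/andP: sr => sr rt; apply: rg => //; apply: le_trans (dW _ _ sr) _.
      by rewrite ler_wpM2l//; lra.
    have g2 : `|B *m (P r - P s)| <= b0 * (a0 * (K * rho e) + a0 * d).
      by apply: le_trans (mulmx_norm_le _ _) _; apply: ler_wpM2l => //; exact: dPs.
    by move: g2; rewrite mulrDr mulrA; lra.
  have := ler_normB ((A *m (P t - P s)) i 0 + Iint (fun r => F r i 0) s t)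
    (Iint (fun r => F r i 0) s t - (t - s) * F s i 0).
  have := ler_wpM2l ba_d ts1.
  rewrite [X in `|X| <= _ -> _](_ : _ =
    (A *m (P t - P s)) i 0 + (t - s) * F s i 0); last by ring.
  lra.
Qed.

End CurveToPseudoOrbit.

(** * Admissible curves extended by rest, and their action *)

Section Admissible.
Context {R : realType} {n : nat}.
Local Notation X := 'cV[R]_n.+1.
Local Notation mu := (@lebesgue_measure R).
Variables (A B : 'M[R]_n.+1) (f : X -> R).
Hypotheses (A_spd : sym_posdef A) (B_spd : sym_posdef B).
Hypothesis f_diff : forall x, differentiable f x.
Hypothesis gradf_cont : continuous (grad f).

Lemma lagrangianE (w dw ddw : R -> X) s : lagrangian A B f w dw ddw s =
  dot (grad f (w s) + A *m ddw s) (invmx B *m (grad f (w s) + A *m ddw s)) +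
  dot (dw s) (B *m dw s).
Proof. by rewrite /lagrangian sqr_qnorm ?sqr_qnorm//; exact: posdef_invmx. Qed.

Variables (N : nat) (u v : X) (w dw ddw : R -> X).
Hypotheses (N_gt0 : (0 < N)%N) (w_adm : admissible N u v w dw ddw).
Hypotheses (u_crit : grad f u = 0) (v_crit : grad f v = 0).

Let a : R := - N%:R.
Let b : R := N%:R.
Let ab : a < b.
Proof. by rewrite /a /b gtrN// ltr0n. Qed.

(* Extension of the trajectory to the real line by rest at [u] and at [v]. *)
Let W := w \o clamp a b.
Let P := dw \o clamp a b.
Let Q s := if s \in `]a, b[%classic then ddw s else 0.

Let W_left s : s <= a -> W s = u.
Proof. by move=> sa; rewrite /W/= clamp_le// ?(ltW ab)//; case: w_adm. Qed.

Let P_left s : s <= a -> P s = 0.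
Proof. by move=> sa; rewrite /P/= clamp_le// ?(ltW ab)//; case: w_adm. Qed.

Let W_right s : b <= s -> W s = v.
Proof. by move=> sb; rewrite /W/= clamp_ge// ?(ltW ab)//; case: w_adm. Qed.

Let P_right s : b <= s -> P s = 0.
Proof. by move=> sb; rewrite /P/= clamp_ge// ?(ltW ab)//; case: w_adm. Qed.

Let coord_within (h : R -> X) i : {within `[a, b], continuous h} ->
  {within `[a, b], continuous (fun s => h s i 0)}.
Proof.
move=> /subspace_continuousP ch; apply/subspace_continuousP => s sab.
apply: (@cvg_comp _ _ _ h (fun M : X => M i 0) _ _ _ (ch s sab)).
exact: coord_continuous.
Qed.

(** Since [dw] vanishes at both ends, its clamped extension coincides with the weak derivative
    patched by 0, so the primitive identities hold on the whole line. *)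
Lemma admissible_curve : curve W P Q.
Proof.
have [[cw cdw W12s] _ _ _ _] := w_adm.
split.
- exact: comp_clamp_continuous (ltW ab) cw.
- exact: comp_clamp_continuous (ltW ab) cdw.
- move=> i; have [_ [_ L2q _]] := W12s i.
  have := patch_loc_int2 L2q; congr loc_int2; apply/funext => s.
  by rewrite patchE /Q; case: ifP => // _; rewrite mxE.
- move=> i s t st; have [[_ L2p wd] _] := W12s i.
  rewrite [LHS](weak_derivative_Iint ab (coord_within cw) L2p wd st).
  congr Iint; apply/funext => r; rewrite patchE; case: ifPn => rab.
    move: rab; rewrite inE/= in_itv/= => /andP[ar rb].
    by rewrite /P/= clamp_id// (ltW ar) (ltW rb).
  move: rab; rewrite notin_setE/= in_itv/= => /negP.
  rewrite negb_and -!leNgt => /orP[ra|br].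
    by rewrite P_left// mxE.
  by rewrite P_right// mxE.
- move=> i s t st; have [_ [_ L2q wd]] := W12s i.
  rewrite [LHS](weak_derivative_Iint ab (coord_within cdw) L2q wd st).
  congr Iint; apply/funext => r.
  by rewrite patchE /Q; case: ifP => // _; rewrite mxE.
Qed.

Let y := residual_density A B f W P Q.

Let y_int : loc_int y.
Proof. exact: (residual_density_int A B gradf_cont admissible_curve). Qed.

Let y_ge0 s : 0 <= y s. Proof. exact: residual_density_ge0. Qed.

Let y_outside s : ~~ (a < s < b) -> y s = 0.
Proof.
move=> nab; have Q0 : Q s = 0.
  by rewrite /Q ifF//; apply/negbTE; rewrite notin_setE/= in_itv/=; apply/negP.
move: nab; rewrite negb_and -!leNgt => /orP[sa|bs];
  rewrite /y /residual_density /residual Q0.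
  by rewrite W_left// P_left// u_crit !mulmx0 !addr0 dot0l mulr0.
by rewrite W_right// P_right// v_crit !mulmx0 !addr0 dot0l mulr0.
Qed.

(** Integrate [residual_densityE]: the cross term gives the energy increment from rest at [u] to
    rest at [v], which is [f v - f u]. *)
Lemma action_residual :
  action A B f N w dw ddw = (Iint y a b + (f u - f v))%:E.
Proof.
have cv := admissible_curve.
have Lint : loc_int (lagrangian A B f W P Q).
  have -> : lagrangian A B f W P Q = (fun s =>
      dot (grad f (W s) + A *m Q s) (invmx B *m (grad f (W s) + A *m Q s)) +
      dot (P s) (B *m P s)) by apply/funext => s; exact: lagrangianE.
  have [cW cP lQ _ _] := cv.
  have lP i : loc_int2 (fun s => P s i 0) by exact: loc_int2_coord.
  have lz i : loc_int2 (fun s => (grad f (W s) + A *m Q s) i 0).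
    have -> : (fun s => (grad f (W s) + A *m Q s) i 0) =
        (fun s => grad f (W s) i 0 + (A *m Q s) i 0).
      by apply/funext => s; rewrite [LHS]mxE.
    apply: loc_int2D; last exact: loc_int2_mulmx.
    apply: (@loc_int2_coord _ _ (fun s => grad f (W s))) => s.
    by apply: cvg_gradf => //; exact: cW.
  by apply: loc_intD; apply: loc_int_dot => // i; exact: loc_int2_mulmx.
(* At [a] and [b] the value of [ddw] is arbitrary, so the two Lagrangians are compared on the open
   interval only. *)
have eqL s : s \in `]a, b[ -> lagrangian A B f w dw ddw s = lagrangian A B f W P Q s.
  move=> sab; rewrite /lagrangian /W /P /Q/= mem_setE sab.
  by move: sab; rewrite in_itv/= => /andP[as_ sb]; rewrite clamp_id// (ltW as_) (ltW sb).
have mL' (i : interval R) : measurable_fun [set` i] (fun s => (lagrangian A B f W P Q s)%:E).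
  by apply/measurable_EFinP; case: Lint => mL _; exact: measurable_funS mL.
have mLo : measurable_fun `]a, b[ (fun s => (lagrangian A B f w dw ddw s)%:E).
  apply: eq_measurable_fun (mL' `]a, b[) => s; rewrite inE => sab.
  by rewrite eqL.
have mLoc : measurable_fun `]a, b] (fun s => (lagrangian A B f w dw ddw s)%:E).
  exact/emeasurable_fun_itv_bndo_bndcP.
rewrite /action -/a -/b.
have -> : (\int[mu]_(s in `[a, b]) (lagrangian A B f w dw ddw s)%:E =
    (Iint (lagrangian A B f W P Q) a b)%:E)%E.
  rewrite -integral_itv_obnd_cbnd// -integral_itv_bndo_bndc//.
  rewrite /Iint /Rintegral fineK; last first.
    by case: Lint => _ iL; exact: integrable_fin_num (iL a b).
  rewrite -[RHS]integral_itv_obnd_cbnd; last exact: mL'.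
  rewrite -[RHS]integral_itv_bndo_bndc; last exact: mL'.
  by apply: eq_integral => s; rewrite inE => sab; rewrite eqL.
rewrite -EFinM; congr EFin.
have yE : y = (fun s => 2^-1 * lagrangian A B f W P Q s +
     dot (residual A B f W P Q s - B *m P s) (P s)).
  by apply/funext => s; rewrite /y residual_densityE// lagrangianE.
have dint : loc_int (fun s => dot (residual A B f W P Q s - B *m P s) (P s)).
  have [_ cP _ _ _] := cv.
  have lP i : loc_int2 (fun s => P s i 0) by exact: loc_int2_coord.
  apply: loc_int_dot => // i; apply: loc_int2_coordB; first exact: residual_int.
  exact: loc_int2_mulmx.
have l1 := loc_intZ 2^-1 Lint.
rewrite yE (IintD _ _ l1 dint) (IintZ _ _ _ Lint).
rewrite -(curve_energy B A_spd f_diff gradf_cont cv (ltW ab)).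
rewrite /energy (W_left (lexx a)) (P_left (lexx a)) (W_right (lexx b)) (P_right (lexx b)).
by rewrite dot0l mulr0; ring.
Qed.

(** Rest at a critical point has zero residual, so all the mass of the nonnegative density lies in
    []a, b[]. *)
Lemma residual_Iint_total s t : s <= t -> Iint y s t <= Iint y a b.
Proof.
move=> st; pose S := Num.min s a; pose T := Num.max t b.
have Ss : S <= s by rewrite ge_min lexx.
have Sa : S <= a by rewrite ge_min lexx orbT.
have tT : t <= T by rewrite le_max lexx.
have bT : b <= T by rewrite le_max lexx orbT.
have i0 p q : p <= q -> q <= a \/ b <= p -> Iint y p q = 0.
  move=> pq out; rewrite -(mul0r (q - p)) -Iint_cst//; apply: eq_Rintegral => x.
  rewrite inE/= in_itv/= => /andP[px xq]; apply: y_outside.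
  rewrite negb_and -!leNgt; case: out => [qa|bp]; first by rewrite (le_trans xq qa).
  by rewrite (le_trans bp px) orbT.
have E1 := Iint_chasles y_int Sa (le_trans (ltW ab) bT).
have E2 := Iint_chasles y_int (ltW ab) bT.
have E3 := Iint_chasles y_int Ss (le_trans st tT).
have E4 := Iint_chasles y_int st tT.
have z1 := i0 _ _ Sa (or_introl (lexx a)).
have z2 := i0 _ _ bT (or_intror (lexx b)).
have p1 := @Iint_ge0 _ y S s y_ge0; have p2 := @Iint_ge0 _ y t T y_ge0.
rewrite -[leRHS]addr0 -z2 -E2 -[leRHS]add0r -z1 -E1 E3 E4.
by rewrite addrCA lerDl addr_ge0.
Qed.

Lemma admissible_extension : exists W P Q : R -> X,
  [/\ curve W P Q, forall s, s <= a -> W s = u /\ P s = 0,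
      forall s, b <= s -> W s = v /\ P s = 0
    & forall s t, s <= t ->
      ((Iint (residual_density A B f W P Q) s t)%:E <=
        action A B f N w dw ddw - (f u - f v)%:E)%E].
Proof.
exists W, P, Q; split.
- exact: admissible_curve.
- by move=> s sa; rewrite W_left// P_left.
- by move=> s sb; rewrite W_right// P_right.
- move=> s t st; rewrite action_residual -EFinB lee_fin addrK.
  exact: residual_Iint_total.
Qed.

End Admissible.

(** * Bounded sublevels, by a Gronwall estimate in time *)

Section Sublevels.
Context {R : realType} {n : nat}.
Local Notation X := 'cV[R]_n.+1.
Variables (T : R) (F : R -> X -> R).

Lemma is_derive_within (g : R -> R) (s : R) : 0 < s < T ->
  derivable_within `[0, T] g s -> is_derive s 1 g (derive_within `[0, T] g s).
Proof.
move=> /andP[s0 sT] /cvgrPdist_le cg; apply: is_derive_increments => e e0.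
have near_itv : \forall r \near s, 0 <= r <= T.
  have d0 : 0 < Num.min s (T - s) by rewrite lt_min s0 subr_gt0.
  apply: filterS (near_dist_lt s d0) => r.
  rewrite lt_min !ltr_norml => /andP[/andP[h1 h2] /andP[h3 h4]].
  by apply/andP; split; lra.
have := cg e e0; rewrite /derive_within; set l := lim _; rewrite /within/= => H.
have H' : \forall r \near s, r != s -> `[0, T]%classic r ->
    `|l - difference_quotient g s r| <= e by exact: H.
apply: filterS2 near_itv H' => r rT Hr.
have [->|rs] := eqVneq r s; first by rewrite !subrr scale0r subrr normr0 mulr0.
have rs0 : r - s != 0 by rewrite subr_eq0.
have := Hr rs; rewrite /= in_itv/= => /(_ rT).
rewrite -(ler_pM2r (_ : 0 < `|r - s|)) ?normr_gt0// -normrM.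
rewrite distrC mulrBl /difference_quotient [(r - s)^-1 *: _]mulrC divfK//.
by rewrite [l * _]mulrC (distrC ((r - s) * l)).
Qed.

Hypotheses (HF0 : F0 T F) (HF1 : F1 T F) (HF2 : F2 T F).

Lemma F_within_continuous (x : X) : {within `[0, T], continuous (F ^~ x)}.
Proof.
have [/subspace_continuousP cF _ _ _] := HF0.
apply/subspace_continuousP => s sT N Nf.
have := cF (s, x) (conj sT I) N Nf.
rewrite /fmap /within/= => -[[N1 N2] /= [n1 n2] sub].
apply: filterS n1 => r N1r rT; apply: (sub (r, x)) => //=.
by split => //=; exact: nbhs_singleton.
Qed.

(** Gronwall for [phi = F + C2 / C1], which satisfies |phi'| <= C1 phi. It works in both directions
    of time because the hypothesis bounds an absolute value. *)
Lemma F_growth (C1 C2 t r : R) (x : X) : 0 < C1 ->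
  (forall t u, 0 <= t <= T -> `|dt_F T F t u| <= C1 * F t u + C2) ->
  0 <= t <= T -> 0 <= r <= T ->
  F r x + C2 / C1 <= (F t x + C2 / C1) * expR (C1 * T).
Proof.
move=> C10 dF.
pose c := C2 / C1; have cE : C2 = C1 * c by rewrite /c mulrC divfK// gt_eqF.
have phi0 s : 0 <= s <= T -> 0 <= F s x + c.
  move=> sT; have := dF s x sT; rewrite cE -mulrDr.
  by move=> /(le_trans (normr_ge0 _)); rewrite pmulr_rge0.
have dFx s : 0 < s < T -> is_derive s 1 (F ^~ x) (dt_F T F s x).
  move=> sT; apply: is_derive_within => //; have [_ H _ _] := HF0.
  have sT' : `[0, T]%classic s by rewrite /= in_itv/=; case/andP: sT => /ltW -> /ltW ->.
  by have [] := H s x sT'.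
have dpsi (k s : R) : 0 < s < T -> is_derive s 1
    (fun s => (F s x + c) * expR (k * s)) ((dt_F T F s x + k * (F s x + c)) * expR (k * s)).
  move=> sT; have d1 := dFx s sT.
  have d2 : is_derive s 1 (fun s : R => k * s) k.
    by have := is_deriveZ k (is_derive_id s 1); move/is_derive_eq; apply; exact: mulr1.
  have d3 : is_derive s 1 (fun s : R => expR (k * s)) (expR (k * s) * k).
    exact: (@is_derive1_comp _ expR (fun s : R => k * s) s _ _ (is_derive_expR _) d2).
  have d4 : is_derive s 1 (fun s : R => F s x + c) (dt_F T F s x).
    by have := is_deriveD d1 (is_derive_cst c s 1); move/is_derive_eq; apply; rewrite addr0.
  have := is_deriveM d4 d3; move/is_derive_eq; apply.
  by change ((F s x + c) * (expR (k * s) * k) + expR (k * s) * dt_F T F s x =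
    (dt_F T F s x + k * (F s x + c)) * expR (k * s)); ring.
have cpsi (k : R) : {within `[0, T], continuous (fun s => (F s x + c) * expR (k * s))}.
  apply/subspace_continuousP => s sT; apply: cvgM.
    apply: cvgD; last exact: cvg_cst.
    by have /subspace_continuousP := @F_within_continuous x; exact.
  apply: cvg_within_filter.
  apply: (@continuous_comp _ _ _ (fun s => k * s) expR); last exact: continuous_expR.
  by apply: cvgMr; exact: cvg_id.
have mono (k p q : R) : 0 <= p -> p <= q -> q <= T -> exists2 s, 0 <= s <= T &
    (F q x + c) * expR (k * q) - (F p x + c) * expR (k * p) =
    ((dt_F T F s x + k * (F s x + c)) * expR (k * s)) * (q - p).
  move=> p0 pq qT.
  have dk (s : R) : s \in `]p, q[ -> is_derive s 1 (fun s => (F s x + c) * expR (k * s))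
     ((dt_F T F s x + k * (F s x + c)) * expR (k * s)).
    rewrite in_itv/= => /andP[ps sq]; apply: dpsi.
    by rewrite (le_lt_trans p0 ps) (lt_le_trans sq qT).
  have ck : {within `[p, q], continuous (fun s => (F s x + c) * expR (k * s))}.
    apply: continuous_subspaceW (cpsi k) => s /=; rewrite !in_itv/= => /andP[ps sq].
    by rewrite (le_trans p0 ps) (le_trans sq qT).
  have [s] := MVT_segment pq dk ck; rewrite in_itv/= => /andP[ps sq] E.
  by exists s => //; rewrite (le_trans p0 ps) (le_trans sq qT).
move=> /andP[t0 tT] /andP[r0 rT]; rewrite -/c.
have pt : 0 <= F t x + c by apply: phi0; rewrite t0.
have eT (k : R) : k <= T -> (F t x + c) * expR (C1 * k) <= (F t x + c) * expR (C1 * T).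
  by move=> kT; rewrite ler_wpM2l// ler_expR ler_pM2l.
have dFs s : 0 <= s <= T -> - (C1 * (F s x + c)) <= dt_F T F s x <= C1 * (F s x + c).
  by move=> sT; have := dF s x sT; rewrite cE -mulrDr ler_norml.
(* Forward, multiplying by [expR (- C1 * s)] gives a nonincreasing product; backward,
   [expR (C1 * s)] gives a nondecreasing one. *)
have [tr|/ltW rt] := leP t r.
  have [s sT E] := mono (- C1) t r t0 tr rT.
  have h : (F r x + c) * expR (- C1 * r) <= (F t x + c) * expR (- C1 * t).
    rewrite -subr_le0 E mulr_le0_ge0 ?subr_ge0// mulr_le0_ge0 ?expR_ge0//.
    by have /andP[_] := dFs s sT; rewrite mulNr subr_le0.
  apply: le_trans (eT (r - t) _); last by lra.
  have := ler_wpM2r (expR_ge0 (C1 * r)) h.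
  rewrite -!mulrA -!expRD mulNr addNr expR0 mulr1.
  by rewrite (_ : - C1 * t + C1 * r = C1 * (r - t))//; ring.
have [s sT E] := mono C1 r t r0 rt tT.
have h : (F r x + c) * expR (C1 * r) <= (F t x + c) * expR (C1 * t).
  rewrite -subr_ge0 E mulr_ge0 ?subr_ge0// mulr_ge0 ?expR_ge0//.
  by have /andP[+ _] := dFs s sT; rewrite lerNl; lra.
apply: le_trans (eT (t - r) _); last by lra.
have := ler_wpM2r (expR_ge0 (- (C1 * r))) h.
rewrite -!mulrA -!expRD subrr expR0 mulr1.
by rewrite (_ : C1 * t - C1 * r = C1 * (t - r))//; ring.
Qed.

Lemma F_bounded_below (t : R) : 0 <= t <= T -> exists C, forall x, - C <= F t x.
Proof.
move=> tT; have [C1 [C2 [C10 C20 dF]]] := HF2.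
exists (C2 / C1) => x.
have tT' : `[0, T]%classic t by rewrite /= in_itv.
have := le_trans (normr_ge0 _) (dF t x tT').
by rewrite -lerBlDr sub0r -ler_pdivrMl// mulrC mulNr.
Qed.

(** (F1) asks for a bound on |F| at all times, while the sublevel is known at time [t] only:
    [F_growth] carries the upper bound over, and (F2) supplies the lower one. *)
Lemma F_sublevel_bounded (t rho : R) : 0 <= t <= T ->
  exists M, forall x, F t x <= rho -> `|x| <= M.
Proof.
move=> tT; have [C1 [C2 [C10 C20 dF]]] := HF2.
have [C HC] := F_bounded_below tT.
pose L := (`|rho| + C2 / C1) * expR (C1 * T) + C2 / C1 + 1.
have c0 : 0 < C2 / C1 by rewrite divr_gt0.
have L0 : 0 < L by rewrite /L; have := @expR_ge0 R (C1 * T); have := normr_ge0 rho; nra.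
have [M [_ HM]] := HF1 L0.
exists (M + 1) => x xrho; apply: (HM (M + 1)); first by rewrite ltrDl.
rewrite /=; apply: ge_ereal_sup => _ [s sT <-].
rewrite lee_fin.
have sT' : 0 <= s <= T by move: sT; rewrite /= in_itv.
have dF' s' u : 0 <= s' <= T -> `|dt_F T F s' u| <= C1 * F s' u + C2.
  by move=> h; apply: dF; rewrite /= in_itv.
have h1 := F_growth x C10 dF' tT sT'.
have h2 : - (C2 / C1) <= F s x.
  have := le_trans (normr_ge0 _) (dF' s x sT').
  by rewrite -lerBlDr sub0r -ler_pdivrMl// mulrC mulNr.
have h3 : (F t x + C2 / C1) * expR (C1 * T) <= (`|rho| + C2 / C1) * expR (C1 * T).
  by rewrite ler_wpM2r ?expR_ge0// lerD2r; exact: le_trans xrho (ler_norm _).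
have h4 : 0 <= (`|rho| + C2 / C1) * expR (C1 * T).
  by rewrite mulr_ge0 ?expR_ge0// addr_ge0// ltW.
rewrite ler_norml; apply/andP; split; rewrite /L; lra.
Qed.

End Sublevels.

(** * From the cost identity to a connection *)

Section Connection.
Context {R : realType} {n : nat}.
Local Notation X := 'cV[R]_n.+1.
Variables (A B : 'M[R]_n.+1) (f : X -> R).
Hypotheses (A_spd : sym_posdef A) (B_spd : sym_posdef B).
Hypothesis f_diff : forall x, differentiable f x.
Hypothesis gradf_cont : continuous (grad f).

Lemma energy_sublevel_bounded (L C : R) : (forall x, - C <= f x) ->
  (exists M, forall x, f x <= L -> `|x| <= M) ->
  exists2 M, 0 <= M & forall x q, energy A f x q <= L -> `|x| <= M /\ `|q| <= M.
Proof.
move=> fC [M1 HM1]; pose M2 := Num.sqrt (`|invmx A| * (2 * (L + C))).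
have M20 : 0 <= M2 by exact: sqrtr_ge0.
exists (Num.max M1 M2); first by rewrite le_max M20 orbT.
move=> x q E; have q0 := posdef_ge0 A_spd q; have fx := fC x.
have fL : f x <= L by move: E; rewrite /energy; lra.
split; first by rewrite le_max HM1.
rewrite le_max; apply/orP; right.
have -> : `|q| = Num.sqrt (`|q| ^+ 2) by rewrite sqrtr_sqr normr_id.
apply: ler_wsqrtr; apply: le_trans (posdef_norm_le A_spd q) _.
by rewrite ler_wpM2l//; move: E; rewrite /energy; lra.
Qed.

(** The sublevel of [f u + 1] fixes [M] and [rho] before [dl] is given. For an action within
    [Num.min eps 1] of the infimum, the 1 keeps the curve in that sublevel and [eps] makes it a
    pseudo-orbit with error [dl]. *)
Lemma cost_connects (u v : X) (C : R) :
  grad f u = 0 -> grad f v = 0 -> (forall x, - C <= f x) ->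
  (exists M, forall x, f x <= f u + 1 -> `|x| <= M) ->
  (f u - f v)%:E = cost A B f u v ->
  exists rho M, [/\ forall e, 0 < e -> 0 < rho e, forall e, rho e <= 1
    & connects A B f rho M u v].
Proof.
move=> gu gv fC fM cuv.
have [M M0 HM] := energy_sublevel_bounded fC fM.
have [rho [rho0 rho1 Hrho]] := curve_pseudo_orbit A_spd B_spd f_diff gradf_cont M0.
exists rho, M; split => // dl dl0.
have [eps eps0 Heps] := Hrho dl dl0.
have e0 : 0 < Num.min eps 1 by rewrite lt_min eps0 ltr01.
have cfin : cost A B f u v \is a fin_num by rewrite -cuv.
have [_ [N [w [dw [ddw [N0 adm ->]]]]] act] := lb_ereal_inf_adherent e0 cfin.
have [W [P [Q [cv Wl Wr Iy]]]] :=
  admissible_extension A_spd B_spd f_diff gradf_cont N0 adm gu gv.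
have Iy1 s t : s <= t -> Iint (residual_density A B f W P Q) s t <= Num.min eps 1.
  move=> st; rewrite -lee_fin; apply: le_trans (Iy s t st) _.
  rewrite leeBlDl//; apply: ltW; apply: lt_le_trans act _.
  by rewrite -/(cost A B f u v) -cuv.
have WPM s : `|W s| <= M /\ `|P s| <= M.
  apply: HM; pose s0 := Num.min s (- N%:R).
  have s0s : s0 <= s by rewrite ge_min lexx.
  have s0N : s0 <= - N%:R by rewrite ge_min lexx orbT.
  have [Ws0 Ps0] := Wl s0 s0N.
  apply: le_trans (curve_energy_le A_spd B_spd f_diff gradf_cont cv s0s) _.
  rewrite Ws0 Ps0 /energy dot0l mulr0 addr0 lerD2l.
  by apply: le_trans (Iy1 _ _ s0s) _; rewrite ge_min lexx orbT.
exists W, P; split.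
- apply: (Heps W P Q) => //; [by move=> s; case: (WPM s)|by move=> s; case: (WPM s)|].
  by move=> s t /Iy1; rewrite le_min => /andP[].
- by exists (- N%:R).
- by exists N%:R.
Qed.

End Connection.

Theorem theorem5p13 (R : realType) (n : nat) (T : R) (A B : 'M[R]_n.+1)
    (F : R -> 'cV[R]_n.+1 -> R)
    (T_gt0 : 0 < T) (A_spd : sym_posdef A) (B_spd : sym_posdef B)
    (HF0 : F0 T F) (HF1 : F1 T F) (HF2 : F2 T F)
    (HF3 : F3 T F) (HF4 : F4 T F) (HF5 : F5 T F)
    (t : R) (t_in : 0 <= t <= T) (u v : 'cV[R]_n.+1)
    (u_crit : critical F t u) (v_crit : critical F t v)
    (cost_uv : (F t u - F t v)%:E = cost A B (F t) u v) :
  exists (m : nat) (us : nat -> 'cV[R]_n.+1) (vs : nat -> R -> 'cV[R]_n.+1),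
    [/\ us 0%N = u, us m = v,
        forall i, (i <= m)%N -> critical F t (us i),
        forall i j, (i <= m)%N -> (j <= m)%N -> us i = us j -> i = j
      & forall i, (1 <= i <= m)%N ->
          [/\ forall s : R,
                [/\ derivable (vs i) s 1, derivable (derive1 (vs i)) s 1
                  & A *m derive1 (derive1 (vs i)) s + B *m derive1 (vs i) s
                    + grad (F t) (vs i s) = 0],
              vs i s @[s --> -oo] --> us i.-1,
              vs i s @[s --> +oo] --> us i,
              derive1 (vs i) s @[s --> -oo] --> (0 : 'cV[R]_n.+1)
            & derive1 (vs i) s @[s --> +oo] --> (0 : 'cV[R]_n.+1)]].
Proof.
have tI : `[0, T]%classic t by rewrite /= in_itv.
have [HC2 _] := HF4.
have [f_diff gradf_diff _] := HC2 t tI.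
have gradf_cont : continuous (grad (F t)).
  by move=> x; apply: differentiable_continuous; exact: gradf_diff.
have [C fC] := F_bounded_below HF2 t_in.
have fM := F_sublevel_bounded HF0 HF1 HF2 (F t u + 1) t_in.
have [rho [M [rho0 rho1 cuv]]] :=
  cost_connects A_spd B_spd f_diff gradf_cont u_crit v_crit fC fM cost_uv.
have crit_isolated x : grad (F t) x = 0 ->
    exists2 r, 0 < r & forall y, `|y - x| <= r -> grad (F t) y = 0 -> y = x.
  move=> gx; have [_ [V /nbhs_ballP[r r0 rV] VE]] := HF5 t tI x gx.
  (* Isolation holds on an open ball of radius [r]; a closed ball inside it is wanted. *)
  exists (r / 2); first by rewrite divr_gt0.
  move=> y yx gy; suff : [set x] y by [].
  rewrite -VE; split => //; apply: rV.
  rewrite -ball_normE /ball_/= distrC; apply: le_lt_trans yx _.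
  by rewrite ltr_pdivrMr// ltr_pMr// ltr1n.
have [m [us [vs [us0 usm gus fus hvs]]]] :=
  connects_chain A_spd B_spd f_diff gradf_cont rho0 rho1 crit_isolated u_crit cuv.
have fus_lt i j : (i < j)%N -> (j <= m)%N -> F t (us j) < F t (us i).
  elim: j => // j IH; rewrite ltnS leq_eqVlt => /orP[/eqP ->|ij] jm; first exact: fus.
  by apply: lt_trans (fus j jm) _; apply: IH => //; exact: ltnW.
exists m, us, vs; split => //.
move=> i j im jm ij; have [lij|lji|//] := ltngtP i j.
  by have := fus_lt _ _ lij jm; rewrite ij ltxx.
by have := fus_lt _ _ lji im; rewrite ij ltxx.
Qed.
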